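(* Let $K$ be an algebraically closed field of characteristic $2$. Let $B\in K[x_1,x_2,x_3]_4$ be a homogeneous polynomial of degree $4$. If the quartic surface $$X:=\{(x,z)\mid z^4+B(x)=0\}\subset\mathbb{P}^3_K,\qquad x=(x_1,x_2,x_3),$$ is normal, then it has at most $7$ singular points. If $B$ is general, $X$ has $7$ $A_3$-singularities.
   Context: $(x_1:x_2:x_3:z)$ are homogeneous coordinates on $\mathbb{P}^3_K$. An $A_n$-singularity is one formally equivalent to $xy=z^{n+1}$. ''General'' means for $B$ in a nonempty Zariski-open subset of $K[x_1,x_2,x_3]_4$. *)

(* Defs.v *)
From HB Require Import structures.
From mathcomp Require Import all_boot all_order all_algebra.
From mathcomp Require Import mpoly.
From mathcomp Require boolp.

Set Implicit Arguments.
Unset Strict Implicit.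
Unset Printing Implicit Defensive.

Import GRing.Theory.
Local Open Scope ring_scope.

Section PowerSeries.
Context (n : nat) (K : comNzRingType).

(** Formal power series, as families of coefficients; the product is defined by
    the same finite sum as [mcoeffM] for polynomials. *)
Record mpseries := MPSeries { pscoef : 'X_{1..n} -> K }.
Implicit Types f g h : mpseries.

HB.instance Definition _ := boolp.gen_eqMixin mpseries.
HB.instance Definition _ := boolp.gen_choiceMixin mpseries.

Lemma mpseriesP f g : pscoef f =1 pscoef g -> f = g.
Proof. by case: f => f; case: g => g /= /boolp.funext ->. Qed.

Definition series_of_mpoly (p : {mpoly K[n]}) := MPSeries (fun m => p@_m).

Definition ps_opp f := MPSeries (fun m => - pscoef f m).
Definition ps_add f g := MPSeries (fun m => pscoef f m + pscoef g m).
Definition ps_scale (c : K) f := MPSeries (fun m => c * pscoef f m).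
Definition ps_mul f g := MPSeries (fun m =>
  \sum_(k : 'X_{1..n < (mdeg m).+1, (mdeg m).+1} | m == (k.1 + k.2)%MM)
    pscoef f k.1 * pscoef g k.2).
Definition ps0 := series_of_mpoly 0.
Definition ps1 := series_of_mpoly 1.

Fact ps_addA : associative ps_add.
Proof. by move=> f g h; apply: mpseriesP => m /=; rewrite addrA. Qed.
Fact ps_addC : commutative ps_add.
Proof. by move=> f g; apply: mpseriesP => m /=; rewrite addrC. Qed.
Fact ps_add0 : left_id ps0 ps_add.
Proof. by move=> f; apply: mpseriesP => m /=; rewrite mcoeff0 add0r. Qed.
Fact ps_addN : left_inverse ps0 ps_opp ps_add.
Proof. by move=> f; apply: mpseriesP => m /=; rewrite mcoeff0 addNr. Qed.

HB.instance Definition _ :=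
  GRing.isZmodule.Build mpseries ps_addA ps_addC ps_add0 ps_addN.

Definition ps_trunc (d : nat) f : {mpoly K[n]} :=
  \sum_(m : 'X_{1..n < d}) pscoef f m *: 'X_[m].

Lemma ps_truncE d f (m : 'X_{1..n}) :
  (mdeg m < d)%N -> (ps_trunc d f)@_m = pscoef f m.
Proof.
move=> ltmd; rewrite /ps_trunc raddf_sum /= (bigD1 (BMultinom ltmd)) //=.
rewrite mcoeffZ mcoeffX eqxx mulr1 big1 ?addr0 // => k.
rewrite -val_eqE /= => neq; rewrite mcoeffZ mcoeffX.
by rewrite (negbTE neq) mulr0.
Qed.

Lemma ps_mulE d f g (p q : {mpoly K[n]}) (m : 'X_{1..n}) : (mdeg m < d)%N ->
    (forall k, (mdeg k < d)%N -> p@_k = pscoef f k) ->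
    (forall k, (mdeg k < d)%N -> q@_k = pscoef g k) ->
  pscoef (ps_mul f g) m = (p * q)@_m.
Proof.
move=> ltmd Hp Hq; rewrite mcoeffM /=; apply: eq_bigr => k _.
by rewrite Hp ?Hq // (leq_trans _ ltmd) ?bmdeg.
Qed.

Fact ps_mulA : associative ps_mul.
Proof.
move=> f g h; apply: mpseriesP => m; pose d := (mdeg m).+1.
pose T := ps_trunc d; have TE k u : (mdeg k < d)%N -> (T u)@_k = pscoef u k.
  by move=> lt; rewrite ps_truncE.
rewrite (@ps_mulE d f (ps_mul g h) (T f) (T g * T h)) //; last 2 first.
- by move=> k; apply: TE.
- by move=> k ltk; rewrite (@ps_mulE d g h (T g) (T h)) // => j; apply: TE.
rewrite (@ps_mulE d (ps_mul f g) h (T f * T g) (T h)) //; last 2 first.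
- by move=> k ltk; rewrite (@ps_mulE d f g (T f) (T g)) // => j; apply: TE.
- by move=> k; apply: TE.
by rewrite mulrA.
Qed.

Fact ps_mulC : commutative ps_mul.
Proof.
move=> f g; apply: mpseriesP => m; pose d := (mdeg m).+1.
pose T := ps_trunc d; have TE k u : (mdeg k < d)%N -> (T u)@_k = pscoef u k.
  by move=> lt; rewrite ps_truncE.
rewrite (@ps_mulE d f g (T f) (T g)) ?(@ps_mulE d g f (T g) (T f)) //;
  try by move=> k; apply: TE.
by rewrite mulrC.
Qed.

Fact ps_mul1 : left_id ps1 ps_mul.
Proof.
move=> f; apply: mpseriesP => m; pose d := (mdeg m).+1.
rewrite (@ps_mulE d ps1 f 1 (ps_trunc d f)) ?mul1r ?ps_truncE // => k ltk.
by rewrite ps_truncE.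
Qed.

Fact ps_mulDl : left_distributive ps_mul ps_add.
Proof.
move=> f g h; apply: mpseriesP => m /=; rewrite -big_split /=.
by apply: eq_bigr => k _; rewrite mulrDl.
Qed.

Fact ps1_neq0 : ps1 != 0.
Proof.
apply/eqP => /(congr1 (fun f => pscoef f 0%MM)) /=.
by rewrite mcoeff1 mcoeff0 eqxx => /eqP; rewrite oner_eq0.
Qed.

HB.instance Definition _ := GRing.Zmodule_isComNzRing.Build mpseries
  ps_mulA ps_mulC ps_mul1 ps_mulDl ps1_neq0.

Fact ps_scaleA a b f : ps_scale a (ps_scale b f) = ps_scale (a * b) f.
Proof. by apply: mpseriesP => m /=; rewrite mulrA. Qed.
Fact ps_scale1 : left_id 1 ps_scale.
Proof. by move=> f; apply: mpseriesP => m /=; rewrite mul1r. Qed.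
Fact ps_scaleDr : right_distributive ps_scale +%R.
Proof. by move=> a f g; apply: mpseriesP => m /=; rewrite mulrDr. Qed.
Fact ps_scaleDl f : {morph ps_scale^~ f : a b / a + b}.
Proof. by move=> a b; apply: mpseriesP => m /=; rewrite mulrDl. Qed.

HB.instance Definition _ := GRing.Zmodule_isLmodule.Build K mpseries
  ps_scaleA ps_scale1 ps_scaleDr ps_scaleDl.

Fact ps_scaleAl (a : K) f g : a *: (f * g) = (a *: f) * g.
Proof.
apply: mpseriesP => m /=; rewrite mulr_sumr.
by apply: eq_bigr => k _; rewrite mulrA.
Qed.

HB.instance Definition _ :=
  GRing.Lmodule_isLalgebra.Build K mpseries ps_scaleAl.

End PowerSeries.

(** Formal equivalence of the hypersurface germs [f = 0] and [g = 0]: a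
    formal change of coordinates carries one equation to the other up to a
    unit.  Every K-algebra automorphism of the power series ring over a field
    is local, hence continuous, hence a change of coordinates. *)
Definition formally_equivalent (n : nat) (K : fieldType)
    (f g : mpseries n K) : Prop :=
  exists phi : {lrmorphism mpseries n K -> mpseries n K},
    bijective phi /\
    exists u v : mpseries n K, u * v = 1 /\ phi f = u * g.

(** [P^n(K)] is the set of lines through the origin of [K^(n+1)]. *)
Notation proj_space n K := {L : {vspace 'rV[K]_n.+1} | \dim L == 1%N}.

Section Hypersurface.
Context (n : nat) (K : fieldType).
Implicit Types (F : {mpoly K[n.+1]}) (f : {mpoly K[n]}).

(** Euler's formula does not make [F] vanish where its partials do when the
    characteristic divides the degree, so both conditions are imposed. *)
Definition singular_point F (P : proj_space n K) : Prop :=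
  forall v : 'rV[K]_n.+1, v \in val P ->
    F.@[v 0] = 0 /\ forall i : 'I_n.+1, (F^`M(i)).@[v 0] = 0.

(** Equation of [F = 0] in the chart [X_i = 1]; the coordinate ['X_k] of the
    chart is the homogeneous coordinate of index [lift i k]. *)
Definition chart_eq F (i : 'I_n.+1) : {mpoly K[n]} :=
  F \mPo [tuple if unlift i j is Some k then 'X_k else 1 | j < n.+1].

Definition translate f (a : 'I_n -> K) : {mpoly K[n]} :=
  f \mPo [tuple 'X_k + (a k)%:MP | k < n].

(** The germ of [F = 0] at [P], read in some chart containing [P] with
    coordinates centered at [P], is formally equivalent to [g = 0]. *)
Definition germ_equivalent F (P : proj_space n K) (g : {mpoly K[n]}) : Prop :=
  exists (i : 'I_n.+1) (v : 'rV[K]_n.+1),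
    [/\ v \in val P, v 0 i = 1 &
      formally_equivalent
        (series_of_mpoly (translate (chart_eq F i) (fun k => v 0 (lift i k))))
        (series_of_mpoly g)].

(** [R], together with [phi], is the localization of [K['X_0..'X_(n-1)]/(f)]
    at the prime ideal [q / (f)]: elements outside [q] become invertible,
    every element of [R] is a fraction with denominator outside [q], and the
    kernel of [phi] is the kernel of the localization map. *)
Definition is_local_ring f (q : {pred {mpoly K[n]}}) (R : comUnitRingType)
    (phi : {rmorphism {mpoly K[n]} -> R}) : Prop :=
  [/\ forall s, s \notin q -> phi s \is a GRing.unit,
      forall r, exists a s, s \notin q /\ r = phi a / phi s &
      forall a, phi a = 0 <-> exists s b, s \notin q /\ s * a = b * f].

Definition integrally_closed (R : idomainType) : Prop :=
  forall u : {fraction R},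
    integralOver (@tofrac R) u -> exists r : R, u = tofrac r.

(** The scheme [F = 0] is normal: its local rings at all points (not only the
    closed ones) are integrally closed domains.  The points lying in the chart
    [X_i = 1] are the prime ideals containing the equation of the chart. *)
Definition normal_hypersurface F : Prop :=
  forall (i : 'I_n.+1) (q : {pred {mpoly K[n]}}),
    idealr_closed q -> prime_idealr_closed q -> chart_eq F i \in q ->
  exists (R : idomainType) (phi : {rmorphism {mpoly K[n]} -> R}),
    is_local_ring (chart_eq F i) q phi /\ integrally_closed R.

End Hypersurface.

Definition A_equation (K : fieldType) (m : nat) : {mpoly K[3]} :=
  'X_(inord 0) * 'X_(inord 1) - 'X_(inord 2) ^+ m.+1.

Definition A_singularity (K : fieldType) (m : nat) (F : {mpoly K[4]})
    (P : proj_space 3 K) : Prop :=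
  germ_equivalent F P (A_equation K m).

(** [U] is the complement of the common zero locus of the polynomials in [I],
    evaluated at the coordinates in a basis; the choice of the basis does not
    matter. *)
Definition zariski_open (K : fieldType) (V : vectType K) (U : V -> Prop) :=
  exists I : {mpoly K[\dim {:V}]} -> Prop,
    forall v : V, U v <->
      exists p, I p /\ p.@[fun j => coord (vbasis {:V}) j v] != 0.

Definition holds_generally (K : fieldType) (V : vectType K) (Q : V -> Prop) :=
  exists U : V -> Prop,
    [/\ zariski_open U, exists v, U v & forall v, U v -> Q v].

(** Homogeneous coordinates: [x_1, x_2, x_3] have indices 0, 1, 2 and [z] is
    the last one. *)
Definition quartic (K : fieldType) (B : {mpoly K[3]}) : {mpoly K[4]} :=
  'X_ord_max ^+ 4 + mwiden B.

(* Main.v *)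
Require Import Defs.
From HB Require Import structures.
From mathcomp Require Import all_boot all_order all_algebra.
From mathcomp Require Import mpoly ring zify.
From mathcomp Require boolp.
Set Implicit Arguments.
Unset Strict Implicit.
Unset Printing Implicit Defensive.
Import GRing.Theory.
Local Open Scope ring_scope.

(* In characteristic 2 every quartic is
     B = Q^2 + x2 x3 L1^2 + x1 x3 L2^2 + x1 x2 L3^2
   with a quadratic form Q and linear forms L_i = sum_j M_ij x_j.  The partial
   derivatives of B vanish at x exactly when the vector (L_i(x)^2)_i, that is
   the image of x under a Frobenius-semilinear map phi with matrix M, is
   proportional to x; and z is determined by x on X.
   If rank M <= 1, all L_i are multiples of one linear form l, so that
   z^4 + B = (z^2 + Q)^2 + l^2 T and (z^2 + Q) / l violates normality.
   If rank M >= 2, rescale the singular points so that phi(x) = x or phi(x) = 0: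
   the vectors fixed by phi have coordinates in F_2 in a basis of fixed vectors,
   which leaves at most 7 points.
   If det M != 0, which is an open condition on B, Lang's theorem gives a basis of
   K^3 fixed by phi, hence exactly 7 points.  At each of them the
   equation is z^4 + a x^2 + mu x y + d y^2 with a, d polynomials and mu != 0; the
   quadratic part splits over the power series ring, and the two factors together
   with z are formal coordinates. *)

(** * Order filtration on formal power series *)

Section Order.
Context (n : nat) (K : comNzRingType).
Implicit Types (f g : mpseries n K) (p : {mpoly K[n]}) (m : 'X_{1..n}).

(** The [d]-th power of the ideal generated by the variables; equality of series is tested modulo
    all these powers. *)
Definition ord_ge d f := forall m, (mdeg m < d)%N -> pscoef f m = 0.

Lemma pscoefD f g m : pscoef (f + g) m = pscoef f m + pscoef g m.
Proof. by []. Qed.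
Lemma pscoefN f m : pscoef (- f) m = - pscoef f m.
Proof. by []. Qed.
Lemma pscoefB f g m : pscoef (f - g) m = pscoef f m - pscoef g m.
Proof. by []. Qed.
Lemma pscoefZ a f m : pscoef (a *: f) m = a * pscoef f m.
Proof. by []. Qed.
Lemma pscoef0 m : pscoef (0 : mpseries n K) m = 0.
Proof. exact: mcoeff0. Qed.

Lemma ord_ge_zero d : ord_ge d 0.
Proof. by move=> m _; apply: pscoef0. Qed.

Lemma ord_geD d f g : ord_ge d f -> ord_ge d g -> ord_ge d (f + g).
Proof. by move=> Hf Hg m lt; rewrite pscoefD Hf // Hg // addr0. Qed.

Lemma ord_geN d f : ord_ge d f -> ord_ge d (- f).
Proof. by move=> Hf m lt; rewrite pscoefN Hf // oppr0. Qed.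

Lemma ord_geB d f g : ord_ge d f -> ord_ge d g -> ord_ge d (f - g).
Proof. by move=> Hf Hg; apply: ord_geD => //; apply: ord_geN. Qed.

Lemma ord_geZ d a f : ord_ge d f -> ord_ge d (a *: f).
Proof. by move=> Hf m lt; rewrite pscoefZ Hf // mulr0. Qed.

Lemma ord_ge_leq d e f : (e <= d)%N -> ord_ge d f -> ord_ge e f.
Proof. by move=> led Hf m lt; apply: Hf; apply: leq_trans lt led. Qed.

Lemma ord_geM d e f g : ord_ge d f -> ord_ge e g -> ord_ge (d + e) (f * g).
Proof.
move=> Hf Hg m lt; rewrite /GRing.mul /= big1 // => -[/= k1 k2] /eqP /(congr1 (@mdeg n)).
rewrite mdegD /=; move: (val k1) (val k2) => {}k1 {}k2 mE.
case: (ltnP (mdeg k1) d) => [/Hf ->|le]; first by rewrite mul0r.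
rewrite [pscoef g _]Hg ?mulr0 //.
rewrite -(ltn_add2l d) (leq_ltn_trans _ lt) //.
by rewrite mE leq_add2r.
Qed.

Lemma ord_ge_sum d I r (P : pred I) F :
  (forall i, P i -> ord_ge d (F i)) -> ord_ge d (\sum_(i <- r | P i) F i).
Proof.
move=> H; elim/big_ind: _ => // [|f g]; first exact: ord_ge_zero.
exact: ord_geD.
Qed.

Lemma ord_ge_eq0 f : (forall d, ord_ge d f) -> f = 0.
Proof. by move=> H; apply: mpseriesP => m; rewrite pscoef0 (H (mdeg m).+1). Qed.

Lemma ord_ge_eq f g : (forall d, ord_ge d (f - g)) -> f = g.
Proof. by move=> /ord_ge_eq0 /eqP; rewrite subr_eq0 => /eqP. Qed.

Lemma ord_ge_trans d f g h : ord_ge d (f - g) -> ord_ge d (g - h) -> ord_ge d (f - h).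
Proof. by move=> Hf Hg; rewrite -(subrKA g); apply: ord_geD. Qed.

Lemma ord_ge_sym d f g : ord_ge d (f - g) -> ord_ge d (g - f).
Proof. by move=> H; rewrite -opprB; apply: ord_geN. Qed.

(* Only the part of positive order needs to contract, since the first iterate
   is assumed to have the right constant term. *)
Lemma contraction_fixpoint (T : mpseries n K -> mpseries n K) f0 :
  (forall d f g, (0 < d)%N -> ord_ge d (f - g) -> ord_ge d.+1 (T f - T g)) ->
  ord_ge 1 (T f0 - f0) -> exists2 f, T f = f & ord_ge 1 (f - f0).
Proof.
move=> Tcon T0; pose u k := iter k T f0.
have uS k : ord_ge k.+1 (u k.+1 - u k).
  by elim: k => [//|k IH]; apply: Tcon.
have uD k l : ord_ge k.+1 (u (k + l)%N - u k).
  elim: l => [|l IH]; first by rewrite addn0 subrr; apply: ord_ge_zero.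
  apply: ord_ge_trans IH; rewrite addnS.
  by apply: ord_ge_leq (uS _); rewrite ltnS leq_addr.
(* A coefficient of degree [d] no longer changes from the [d]-th iterate on, so the limit is read
   off along the diagonal. *)
pose f := MPSeries (fun m => pscoef (u (mdeg m)) m).
have fu k : ord_ge k.+1 (f - u k).
  move=> m; rewrite ltnS => le; rewrite pscoefB /=.
  apply/eqP; rewrite -oppr_eq0 opprB -pscoefB; apply/eqP.
  by rewrite -(subnKC le) uD.
exists f; last exact: fu 0%N.
apply: ord_ge_eq => -[//|d].
apply: (@ord_ge_leq d.+2) => //.
apply: (@ord_ge_trans _ _ (u d.+1)); last exact: ord_ge_sym (fu d.+1).
exact: Tcon (fu d).
Qed.

Lemma series_of_mpoly_is_linear : linear (@series_of_mpoly n K).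
Proof.
by move=> a p q; apply: mpseriesP => m; rewrite pscoefD pscoefZ /= linearP.
Qed.

Lemma series_of_mpoly_is_monoid_morphism : monoid_morphism (@series_of_mpoly n K).
Proof. by split=> // p q; apply: mpseriesP => m /=; rewrite mcoeffM. Qed.

HB.instance Definition _ := GRing.isLinear.Build K {mpoly K[n]} (mpseries n K)
  _ (@series_of_mpoly n K) series_of_mpoly_is_linear.
HB.instance Definition _ := GRing.isMonoidMorphism.Build {mpoly K[n]}
  (mpseries n K) (@series_of_mpoly n K) series_of_mpoly_is_monoid_morphism.

Lemma ord_ge_trunc d f : ord_ge d (f - series_of_mpoly (ps_trunc d f)).
Proof. by move=> m lt; rewrite pscoefB /= ps_truncE // subrr. Qed.

End Order.

(** * Substitution of power series *)

Section Substitution.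
Context (n : nat) (K : comNzRingType).
Implicit Types (f : mpseries n K) (p : {mpoly K[n]}) (m : 'X_{1..n}).
Implicit Types (g h : 'I_n -> mpseries n K).

Definition ps_eval g : {mpoly K[n]} -> mpseries n K := mmap (in_alg _) g.

Lemma ps_evalD g p q : ps_eval g (p + q) = ps_eval g p + ps_eval g q.
Proof. exact: mmapD. Qed.
Lemma ps_evalB g p q : ps_eval g (p - q) = ps_eval g p - ps_eval g q.
Proof. exact: mmapB. Qed.
Lemma ps_evalZ g a p : ps_eval g (a *: p) = a *: ps_eval g p.
Proof. by rewrite /ps_eval mmapZ /= mulr_algl. Qed.
Lemma ps_evalM g p q : ps_eval g (p * q) = ps_eval g p * ps_eval g q.
Proof. by apply: (mmap_is_multiplicative _ _).1. Qed.
Lemma ps_eval1 g : ps_eval g 1 = 1.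
Proof. by rewrite /ps_eval mmapC /= scale1r. Qed.
Lemma ps_evalX g i : ps_eval g 'X_i = g i.
Proof. by rewrite /ps_eval mmapX mmap1U. Qed.

Lemma ord_ge_monomial d g m : (forall i, ord_ge d (g i)) ->
  ord_ge (d * mdeg m) (mmap1 g m).
Proof.
move=> Hg; rewrite /mmap1 mdegE big_distrr /=.
elim/big_ind2: _ => // [e f e' f'|i _]; first exact: ord_geM.
elim: (m i) => [|k IH]; first by rewrite muln0.
by rewrite exprS mulnS; apply: ord_geM.
Qed.

Lemma ord_ge_eval d g p : (forall i, ord_ge 1 (g i)) ->
  (forall m, (mdeg m < d)%N -> p@_m = 0) -> ord_ge d (ps_eval g p).
Proof.
move=> Hg Hp; rewrite /ps_eval /mmap; apply: ord_ge_sum => m _ /=.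
rewrite mulr_algl; case: (ltnP (mdeg m) d) => [/Hp ->|le].
  by rewrite scale0r; apply: ord_ge_zero.
by apply/ord_geZ/(ord_ge_leq le); rewrite -[mdeg m]mul1n; apply: ord_ge_monomial.
Qed.

(** When no [g i] has a constant term, the terms of [f] of degree above [mdeg m] do not contribute
    to the coefficient at [m], so a truncation computes the infinite sum. *)
Definition ps_subst g f : mpseries n K :=
  MPSeries (fun m => pscoef (ps_eval g (ps_trunc (mdeg m).+1 f)) m).

Lemma ps_substE d g f p : (forall i, ord_ge 1 (g i)) ->
  ord_ge d (f - series_of_mpoly p) -> ord_ge d (ps_subst g f - ps_eval g p).
Proof.
move=> Hg Hp m lt; rewrite pscoefB /= -pscoefB -ps_evalB.
apply: (@ord_ge_eval (mdeg m).+1) => // k ltk.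
rewrite mcoeffB ps_truncE //; have := Hp k (leq_trans ltk lt).
by rewrite pscoefB.
Qed.

Definition local_morphism (phi : mpseries n K -> mpseries n K) :=
  forall d f, ord_ge d f -> ord_ge d (phi f).

Lemma ps_substP g : (forall i, ord_ge 1 (g i)) ->
  exists2 phi : {lrmorphism mpseries n K -> mpseries n K},
    local_morphism phi & forall i, phi (series_of_mpoly 'X_i) = g i.
Proof.
move=> Hg; have approx d f := @ord_ge_trunc n K d f.
have SE d f p : ord_ge d (f - series_of_mpoly p) ->
  ord_ge d (ps_subst g f - ps_eval g p) by apply: ps_substE.
have lin : linear (ps_subst g).
  move=> a f f'; apply: ord_ge_eq => d.
  pose p := ps_trunc d f; pose q := ps_trunc d f'.
  apply: (@ord_ge_trans _ _ _ _ (ps_eval g (a *: p + q))).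
    apply: SE; rewrite linearP opprD addrACA -scalerBr.
    by apply: ord_geD; first apply: ord_geZ; apply: approx.
  rewrite ps_evalD ps_evalZ opprD addrACA -scalerBr.
  by apply: ord_geD; first apply: ord_geZ; apply/ord_ge_sym/SE/approx.
have prodB (d : nat) (a a' b b' : mpseries n K) :
    ord_ge d (a - a') -> ord_ge d (b - b') -> ord_ge d (a * b - a' * b').
  move=> Ha Hb; have ->: a * b - a' * b' = (a - a') * b + a' * (b - b') by ring.
  apply: ord_geD; first by rewrite -[d]addn0; apply: ord_geM.
  by rewrite -[d]add0n; apply: ord_geM.
have mult : monoid_morphism (ps_subst g).
  split=> [|f f'].
    apply: ord_ge_eq => d; rewrite -[X in _ - X](ps_eval1 g); apply: SE.
    by rewrite rmorph1 subrr; apply: ord_ge_zero.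
  apply: ord_ge_eq => d.
  pose p := ps_trunc d f; pose q := ps_trunc d f'.
  apply: (@ord_ge_trans _ _ _ _ (ps_eval g (p * q))).
    by apply: SE; rewrite rmorphM; apply: prodB; apply: approx.
  by rewrite ps_evalM; apply: prodB; apply/ord_ge_sym/SE/approx.
pose phi : {lrmorphism mpseries n K -> mpseries n K} :=
  HB.pack (ps_subst g)
    (GRing.isLinear.Build K (mpseries n K) (mpseries n K) _ (ps_subst g) lin)
    (GRing.isMonoidMorphism.Build (mpseries n K) (mpseries n K) (ps_subst g) mult).
exists phi => [d f Hf|i].
  have /SE : ord_ge d (f - series_of_mpoly 0) by rewrite (raddf0 (@series_of_mpoly n K)) subr0.
  by rewrite /ps_eval mmap0 subr0.
apply: ord_ge_eq => d; rewrite -(ps_evalX g); apply: SE.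
by rewrite subrr; apply: ord_ge_zero.
Qed.

Implicit Types phi psi : {lrmorphism mpseries n K -> mpseries n K}.

Lemma local_morphism_mpoly phi p :
  phi (series_of_mpoly p) = ps_eval (fun i => phi (series_of_mpoly 'X_i)) p.
Proof.
elim/mpolyind: p => [|c m p _ _ IH].
  by rewrite /ps_eval mmap0 !linear0.
rewrite ps_evalD ps_evalZ -IH !linearP /=; congr (_ *: _ + _).
rewrite /ps_eval mmapX /mmap1 mpolyXE_id !rmorph_prod /=.
by apply: eq_bigr => i _; rewrite !rmorphXn.
Qed.

(** Polynomials are dense for the order filtration, and on them both morphisms are evaluation at the
    images of the variables. *)
Lemma local_morphism_ext phi psi : local_morphism phi -> local_morphism psi ->
  (forall i, phi (series_of_mpoly 'X_i) = psi (series_of_mpoly 'X_i)) ->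
  phi =1 psi.
Proof.
move=> Hphi Hpsi E f; apply: ord_ge_eq => d; pose p := series_of_mpoly (ps_trunc d f).
apply: (@ord_ge_trans _ _ _ _ (phi p)).
  by rewrite -raddfB; apply/Hphi/ord_ge_trunc.
rewrite (_ : phi p = psi p).
  by rewrite -raddfB; apply/Hpsi/ord_ge_sym/ord_ge_trunc.
by rewrite /p !local_morphism_mpoly /ps_eval /mmap; apply: eq_bigr => m _;
  congr (_ * _); apply: mmap1_eq.
Qed.

End Substitution.

Lemma choice_bijective (A B : Type) (f : A -> B) :
  injective f -> (forall y, exists x, f x = y) -> bijective f.
Proof.
move=> inj_f /boolp.choice[g gK]; exists g => // x.
by apply: inj_f; rewrite gK.
Qed.

(** * Formal inverse function theorem *)

Section Inverse.
Context (n : nat) (K : fieldType).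
Implicit Types (f : mpseries n K) (p : {mpoly K[n]}) (m : 'X_{1..n}).
Implicit Types (g h : 'I_n -> mpseries n K).
Implicit Types phi psi : {lrmorphism mpseries n K -> mpseries n K}.
Local Notation X i := (series_of_mpoly 'X_i : mpseries n K).

Lemma ord_ge_mpolyX i : ord_ge 1 (X i).
Proof.
move=> m; rewrite ltnS leqn0 mdeg_eq0 => /eqP -> /=.
by rewrite mcoeffX mnm1_eq0.
Qed.

(** Exchanging one factor of order 1 for another that agrees with it to order 2 changes a product
    only in degrees above that of the monomial; [H] propagates this through products. *)
Lemma ord_ge_monomialB g h m : (forall i, ord_ge 1 (g i)) ->
  (forall i, ord_ge 1 (h i)) -> (forall i, ord_ge 2 (g i - h i)) ->
  ord_ge (mdeg m).+1 (mmap1 g m - mmap1 h m).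
Proof.
move=> Hg Hh Hgh; rewrite mdegE /mmap1.
pose H e (a b : mpseries n K) := [/\ ord_ge e a, ord_ge e b & ord_ge e.+1 (a - b)].
have H1 : H 0%N 1 1 by split=> //; rewrite subrr; apply: ord_ge_zero.
have HM e a b e' a' b' : H e a b -> H e' a' b' -> H (e + e')%N (a * a') (b * b').
  case=> ea eb eab [ea' eb' eab']; split; try exact: ord_geM.
  have ->: a * a' - b * b' = (a - b) * a' + b * (a' - b') by ring.
  by apply: ord_geD; [rewrite -addSn | rewrite -addnS]; apply: ord_geM.
suff [] : H (\sum_i m i)%N (\prod_i g i ^+ m i) (\prod_i h i ^+ m i) by [].
apply: (big_ind3 H) => // i _.
elim: (m i) => [//|k IH]; rewrite !exprS -add1n; apply: HM => //.
Qed.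

(** A morphism tangent to the identity fixes each monomial up to terms of higher degree; the tail of
    [f] beyond degree [d] is negligible. *)
Lemma unipotent_morphism_ord phi d f : local_morphism phi ->
  (forall i, ord_ge 2 (phi (X i) - X i)) -> ord_ge d f -> ord_ge d.+1 (phi f - f).
Proof.
move=> Hphi HX Hf; pose p := ps_trunc d.+1 f; pose P := series_of_mpoly p.
have -> : phi f - f = (phi (f - P) - (f - P)) + (phi P - P).
  by rewrite raddfB /=; ring.
apply: ord_geD.
  by apply: ord_geB; first apply: Hphi; apply: ord_ge_trunc.
rewrite {1}/P local_morphism_mpoly /P {2}[p]mpolyE linear_sum /= /ps_eval /mmap.
rewrite -sumrB; apply: ord_ge_sum => m _ /=.
rewrite linearZ /= mulr_algl -scalerBr.
have [lt|le] := ltnP (mdeg m) d.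
  rewrite ps_truncE ?(leq_trans lt) // Hf // scale0r; exact: ord_ge_zero.
apply: ord_geZ; apply: (@ord_ge_leq _ _ (mdeg m).+1) => //.
have -> : series_of_mpoly 'X_[m] = mmap1 (fun i => X i) m.
  rewrite /mmap1 mpolyXE_id rmorph_prod /=; apply: eq_bigr => i _.
  by rewrite rmorphXn.
apply: ord_ge_monomialB => // i; last exact: ord_ge_mpolyX.
by apply/Hphi/ord_ge_mpolyX.
Qed.

(** Since [phi - id] raises the order, an element of the kernel has infinite order, and [phi f1 = f]
    is solved as the fixed point equation [f1 = f - (phi f1 - f1)]. *)
Lemma unipotent_morphism_bij phi : local_morphism phi ->
  (forall i, ord_ge 2 (phi (X i) - X i)) -> bijective phi.
Proof.
move=> Hphi HX; have ordS d f := @unipotent_morphism_ord phi d f Hphi HX.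
apply: choice_bijective => [f f' E|f].
  apply: ord_ge_eq; elim=> [//|d /ordS].
  by rewrite raddfB /= E subrr sub0r => /ord_geN; rewrite opprK.
have [d a b _ Hab||f1 E1 _] :=
    @contraction_fixpoint n K (fun f1 => f - (phi f1 - f1)) f.
- have ->: f - (phi a - a) - (f - (phi b - b)) = - (phi (a - b) - (a - b)).
    by rewrite raddfB /=; ring.
  exact/ord_geN/ordS.
- have ->: f - (phi f - f) - f = - (phi f - f) by ring.
  exact/ord_geN/ordS.
exists f1; apply/esym/eqP; rewrite -subr_eq0; apply/eqP/(addIr f1).
by rewrite add0r -[RHS]E1; ring.
Qed.

(** The Jacobian matrix at the origin. *)
Definition linear_part g : 'M[K]_n := \matrix_(i, j) pscoef (g i) U_(j)%MM.

Definition ps_linear (A : 'M[K]_n) i : mpseries n K := \sum_j A i j *: X j.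

Lemma ord_ge_linear A i : ord_ge 1 (ps_linear A i).
Proof. by apply: ord_ge_sum => j _; apply/ord_geZ/ord_ge_mpolyX. Qed.

Lemma pscoef_sum I r (P : pred I) (F : I -> mpseries n K) m :
  pscoef (\sum_(i <- r | P i) F i) m = \sum_(i <- r | P i) pscoef (F i) m.
Proof.
elim/big_rec2: _ => [|i y x _ <-]; first exact: pscoef0.
by rewrite pscoefD.
Qed.

Lemma pscoef_linear A i j : pscoef (ps_linear A i) U_(j)%MM = A i j.
Proof.
rewrite pscoef_sum (bigD1 j) //= mcoeffX eqxx mulr1 big1 ?addr0 // => k neq.
rewrite mcoeffX; case: eqP => [/mnmP/(_ k)|_]; last by rewrite mulr0.
by rewrite !mnm1E eqxx eq_sym (negbTE neq).
Qed.

Lemma linear_partE g i : (forall i, ord_ge 1 (g i)) ->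
  ord_ge 2 (g i - ps_linear (linear_part g) i).
Proof.
move=> Hg m; rewrite ltnS leq_eqVlt => /orP[/mdeg1P[j /eqP ->]|lt1].
  by rewrite pscoefB pscoef_linear mxE subrr.
by rewrite pscoefB Hg // ord_ge_linear // subrr.
Qed.

Lemma linear_morphismP A : exists2 phi : {lrmorphism mpseries n K -> mpseries n K},
  local_morphism phi & forall i, phi (X i) = ps_linear A i.
Proof. by apply: ps_substP; apply: ord_ge_linear. Qed.

Lemma linear_morphismM phi A B i : (forall i, phi (X i) = ps_linear B i) ->
  phi (ps_linear A i) = ps_linear (A *m B) i.
Proof.
move=> phiX; rewrite /ps_linear linear_sum /=.
under eq_bigr do rewrite linearZ /= phiX scaler_sumr.
rewrite exchange_big; apply: eq_bigr => j _ /=.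
by rewrite mxE scaler_suml; apply: eq_bigr => k _; rewrite scalerA.
Qed.

Lemma ps_linear1 i : ps_linear 1%:M i = X i.
Proof.
rewrite /ps_linear (bigD1 i) //= mxE eqxx scale1r big1 ?addr0 // => j.
by rewrite eq_sym mxE => /negbTE ->; rewrite scale0r.
Qed.

Lemma linear_morphismK A B phi psi : A *m B = 1%:M ->
  local_morphism phi -> local_morphism psi ->
  (forall i, phi (X i) = ps_linear A i) -> (forall i, psi (X i) = ps_linear B i) ->
  cancel phi psi.
Proof.
move=> AB Hphi Hpsi phiX psiX f.
pose psiphi : {lrmorphism mpseries n K -> mpseries n K} := psi \o phi.
pose id_ : {lrmorphism mpseries n K -> mpseries n K} := idfun.
apply: (@local_morphism_ext n K psiphi id_) => [d f1 /Hphi/Hpsi //|//|i] /=.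
by rewrite phiX (linear_morphismM _ _ psiX) AB ps_linear1.
Qed.

(** Composing with the linear substitution inverse to the Jacobian matrix leaves a morphism tangent
    to the identity, which is bijective. *)
Theorem formal_inverse phi : local_morphism phi ->
  linear_part (fun i => phi (X i)) \in unitmx -> bijective phi.
Proof.
move=> Hphi; set g := fun i => phi (X i) => unitL.
have [psi Hpsi psiX] := linear_morphismP (invmx (linear_part g)).
have [psi' Hpsi' psiX'] := linear_morphismP (linear_part g).
have psiK : cancel psi psi' by apply: linear_morphismK psiX psiX'; rewrite ?mulVmx.
have psiK' : cancel psi' psi by apply: linear_morphismK psiX' psiX; rewrite ?mulmxV.
pose chi : {lrmorphism mpseries n K -> mpseries n K} := psi \o phi.
have chi_bij : bijective chi.
  apply: unipotent_morphism_bij => [d f /Hphi/Hpsi //|i] /=.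
  have : ord_ge 2 (psi (g i - ps_linear (linear_part g) i)).
    by apply/Hpsi/linear_partE => k; apply/Hphi/ord_ge_mpolyX.
  by rewrite raddfB /= (linear_morphismM _ _ psiX) mulmxV // ps_linear1.
apply: (@eq_bij _ _ (psi' \o chi)); last by move=> f /=; rewrite psiK.
by apply: bij_comp chi_bij; exists psi.
Qed.

End Inverse.

(** * Normal form of an A3-singularity in characteristic 2 *)

Section MorseA3.
Context (K : closedFieldType) (charK : 2%N \in [pchar K]).
Local Notation ps := (mpseries 3 K).
Local Notation cst c := (series_of_mpoly c%:MP : ps).
Local Notation X k := (series_of_mpoly 'X_(inord k : 'I_3) : ps).

Lemma ord_ge_mull n (R : comNzRingType) d (f g : mpseries n R) :
  ord_ge d g -> ord_ge d (f * g).
Proof. by move=> Hg; rewrite -[d]add0n; apply: ord_geM. Qed.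

Lemma ord_ge_subC n (R : comNzRingType) (f : mpseries n R) :
  ord_ge 1 (f - series_of_mpoly (pscoef f 0%MM)%:MP).
Proof.
move=> m; rewrite ltnS leqn0 mdeg_eq0 => /eqP ->.
by rewrite pscoefB /= mcoeffC eqxx mulr1 subrr.
Qed.

Lemma linear_part_linear n (F : fieldType) (g : 'I_n -> mpseries n F) N :
  (forall i, ord_ge 2 (g i - ps_linear N i)) -> linear_part g = N.
Proof.
move=> Hg; apply/matrixP => i j; rewrite mxE.
have /eqP := Hg i U_(j)%MM (eq_leq (congr1 succn (mdeg1 j))).
by rewrite pscoefB subr_eq0 pscoef_linear => /eqP.
Qed.

Lemma sum_ord3 (V : nmodType) (F : 'I_3 -> V) :
  \sum_i F i = F (inord 0) + F (inord 1) + F (inord 2).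
Proof.
rewrite !big_ord_recl big_ord0 addr0 addrA.
by congr (F _ + F _ + F _); apply: val_inj; rewrite /= inordK.
Qed.

Lemma quadratic_root (a b c : K) : b != 0 -> exists t, a * t ^+ 2 + b * t + c = 0.
Proof.
move=> nzb; pose p := a%:P * 'X^2 + b%:P * 'X + c%:P.
have /closed_rootP[t] : size p != 1%N.
  apply/eqP => sz; have: p`_1 = 0 by rewrite nth_default ?sz.
  rewrite !coefD !coefCM coefXn coefX coefC /= mulr0 mulr1 add0r addr0.
  by move/eqP; rewrite (negbTE nzb).
rewrite /root /p !(hornerD, hornerM, hornerC, hornerXn, hornerX) => /eqP.
by exists t.
Qed.

(** With [tau] a root of [a t^2 + mu t + d], the quadratic part is
    [(x + tau y)(a x + (mu + a tau) y)]: in characteristic 2 the term [2 a tau x y] vanishes and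
    [d = a tau^2 + mu tau]. The two factors and [z] have an invertible Jacobian matrix because
    [mu != 0]. *)
Theorem A3_normal_form (A D : {mpoly K[3]}) (mu : K) : mu != 0 ->
  formally_equivalent
    (series_of_mpoly ('X_(inord 2) ^+ 4 + (A * 'X_(inord 0) ^+ 2 +
       mu%:MP * 'X_(inord 0) * 'X_(inord 1) + D * 'X_(inord 1) ^+ 2)))
    (series_of_mpoly (A_equation K 3)).
Proof.
move=> nz_mu.
have two0 : 2%:R = 0 :> ps by rewrite -scaler_nat (pcharf0 charK) scale0r.
pose a : ps := series_of_mpoly A; pose d : ps := series_of_mpoly D.
pose m := cst mu; pose m' := cst mu^-1.
have mm' : m * m' = 1 by rewrite -rmorphM -mpolyCM mulfV // rmorph1.
have [t0 t0E] := quadratic_root (pscoef a 0%MM) (pscoef d 0%MM) nz_mu.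
pose a0 := cst (pscoef a 0%MM); pose d0 := cst (pscoef d 0%MM).
have t0E' : a0 * (cst t0) ^+ 2 + m * cst t0 + d0 = 0.
  by rewrite -rmorphXn -!rmorphM -!rmorphD /= -rmorphXn -!rmorphM -!rmorphD t0E !raddf0.
(* The map [t -> (a t^2 + d) / mu] contracts, because [s^2 - t^2 = (s - t)^2] doubles a positive
   order; [t0] is the constant term of the root. *)
have [e s t e_gt0 Hst||tau tauE tau0] :=
    @contraction_fixpoint 3 K (fun t => m' * (a * t ^+ 2 + d)) (cst t0).
- have ->: m' * (a * s ^+ 2 + d) - m' * (a * t ^+ 2 + d) =
    m' * a * ((s - t) * (s - t)) + 2%:R * (m' * a * (s * t - t ^+ 2)) by ring.
  rewrite two0 mul0r addr0; apply: ord_ge_mull.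
  by apply: (@ord_ge_leq _ _ (e + e)); [rewrite -addn1 leq_add2l|apply: ord_geM].
- have -> : m' * (a * cst t0 ^+ 2 + d) - cst t0 = m' * (cst t0 ^+ 2 * (a - a0) + (d - d0))
    + m' * (a0 * cst t0 ^+ 2 + m * cst t0 + d0) - (m * m' - 1) * cst t0
    - 2%:R * cst t0 by ring.
  rewrite two0 mul0r subr0 t0E' mulr0 addr0 mm' subrr mul0r subr0.
  by apply/ord_ge_mull/ord_geD; first apply: ord_ge_mull; apply: ord_ge_subC.
have {}tauE : a * tau ^+ 2 + m * tau + d = 0.
  have -> : a * tau ^+ 2 + m * tau + d = m * (m' * (a * tau ^+ 2 + d) - tau)
    - (m * m' - 1) * (a * tau ^+ 2 + d) + 2%:R * (m * tau) by ring.
  by rewrite tauE mm' two0 !subrr; ring.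
pose gs := [:: X 0 + tau * X 1; a * X 0 + (m + a * tau) * X 1; X 2].
pose g (i : 'I_3) := gs`_i.
have ordX i : ord_ge 1 (X i) by apply: ord_ge_mpolyX.
have Hg i : ord_ge 1 (g i).
  case: i => -[|[|[|//]]] lt; rewrite /g /=.
  - by apply: ord_geD => //; apply: ord_ge_mull.
  - by apply: ord_geD; apply: ord_ge_mull.
  - exact: ordX.
have [phi Hphi phiX] := ps_substP Hg.
have phi_bij : bijective phi.
  apply: formal_inverse => //.
  pose al := pscoef a 0%MM.
  (* [N] is the Jacobian matrix of [g], of determinant [mu], and [N'] is its inverse. *)
  pose N : 'M[K]_3 := \matrix_(i, j)
     (nth [::] [:: [:: 1; t0; 0]; [:: al; mu + al * t0; 0]; [:: 0; 0; 1]] i)`_j.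
  pose N' : 'M[K]_3 := \matrix_(i, j)
     (nth [::] [:: [:: 1 + al * t0 / mu; - t0 / mu; 0];
                   [:: - al / mu; mu^-1; 0]; [:: 0; 0; 1]] i)`_j.
  rewrite (@linear_part_linear _ _ _ N).
    have : N *m N' = 1%:M; last by case/mulmx1_unit.
    apply/matrixP => i j; rewrite !mxE 3!big_ord_recl big_ord0 !mxE.
    by case: i => -[|[|[|//]]] lti; case: j => -[|[|[|//]]] ltj /=; field.
  have cstZ c (f : ps) : c *: f = cst c * f.
    rewrite -[f in LHS]mul1r scalerAl -(rmorph1 (@series_of_mpoly 3 K)) -linearZ /=.
    by rewrite -mul_mpolyC mulr1.
  have a0E : cst al = a0 by [].
  have cstD c c' : cst (c + c') = cst c + cst c' by rewrite !raddfD.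
  have cstM c c' : cst (c * c') = cst c * cst c' by rewrite mpolyCM rmorphM.
  have cst0 : cst 0 = 0 by rewrite !raddf0.
  have cst1 : cst 1 = 1 by rewrite !rmorph1.
  have ordM (u v : ps) : ord_ge 1 u -> ord_ge 1 v -> ord_ge 2 (u * v) by apply: ord_geM.
  have a_a0 : ord_ge 1 (a - a0) by apply: ord_ge_subC.
  move=> i; rewrite phiX /ps_linear sum_ord3 !mxE !inordK //.
  case: i => -[|[|[|//]]] lti; rewrite /g /gs /= !cstZ ?cstD ?cstM ?cst0 ?cst1 ?a0E.
  - set u := (X in ord_ge 2 X). have -> : u = (tau - cst t0) * X 1 by rewrite /u; ring.
    exact: ordM.
  - set u := (X in ord_ge 2 X).
    have -> : u = (a - a0) * X 0 + ((a - a0) * tau) * X 1 + (a0 * (tau - cst t0)) * X 1.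
      by rewrite /u -/m; ring.
    apply: ord_geD; first apply: ord_geD; apply: ordM => //.
      by rewrite mulrC; apply: ord_ge_mull.
    exact: ord_ge_mull.
  - rewrite !mul0r mul1r !add0r subrr; exact: ord_ge_zero.
(* The substitution sends [x y - z^4] to the given equation, whereas the equivalence is asked in the
   other direction, so its inverse is taken. *)
have [psi phiK psiK] := phi_bij.
have lin : linear psi by apply: can2_linear phiK psiK.
have mul : monoid_morphism psi by apply: can2_monoid_morphism phiK psiK.
pose Psi : {lrmorphism ps -> ps} := HB.pack psi
  (GRing.isLinear.Build K ps ps _ psi lin) (GRing.isMonoidMorphism.Build ps ps psi mul).
exists Psi; split; first by exists phi.
exists 1, 1; split; rewrite !mul1r //.
apply: (can_inj phiK); rewrite psiK /A_equation.
rewrite !(rmorphB, rmorphD, rmorphM, rmorphXn) /= !phiX.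
rewrite /g !inordK //= -/a -/d -/m.
have -> : d = - (a * tau ^+ 2 + m * tau) + (a * tau ^+ 2 + m * tau + d) by ring.
rewrite tauE; set L := LHS.
have -> : L = L + 2%:R * (X 0 * X 1 * (a * tau)
    + tau * (m + a * tau) * X 1 ^+ 2 - X 2 ^+ 4) + 0 by rewrite two0; ring.
by rewrite /L; ring.
Qed.

End MorseA3.

(** * Frobenius-semilinear maps *)

Section FrobeniusLinear.
Context (K : closedFieldType) (charK : 2%N \in [pchar K]).
Local Notation frob := (pFrobenius_aut charK).

Lemma nth_root_exists n (a : K) : (0 < n)%N -> exists x, x ^+ n = a.
Proof.
move=> n_gt0; have /closed_rootP[x] : size ('X^n - a%:P : {poly K}) != 1%N.
  by rewrite size_XnsubC // eqSS -lt0n.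
by rewrite /root !hornerE subr_eq0 => /eqP; exists x.
Qed.

Lemma free_subset_span (vT : vectType K) (s : seq vT) :
  exists e, [/\ {subset e <= s}, free e & <<e>>%VS = <<s>>%VS].
Proof.
elim: s => [|x s [e [sub_es free_e spanE]]]; first by exists [::]; rewrite nil_free.
have [xe|xe] := boolP (x \in <<e>>%VS).
  exists e; split=> // [y /sub_es ys|]; first by rewrite inE ys orbT.
  rewrite span_cons -spanE; apply/esym/addv_idPr.
  by rewrite -memvE.
exists (x :: e); split; last by rewrite !span_cons spanE.
  by move=> y; rewrite !inE => /orP[->|/sub_es ->]; rewrite ?orbT.
by rewrite free_cons xe.
Qed.

Section Map.
Context (n : nat) (A : 'M[K]_n).
Implicit Types x y : 'rV[K]_n.

Definition frobmul x : 'rV[K]_n := map_mx frob x *m A.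

Lemma frobmulZ c x : frobmul (c *: x) = c ^+ 2 *: frobmul x.
Proof. by rewrite /frobmul map_mxZ -scalemxAl. Qed.

Lemma frobmulD x y : frobmul (x + y) = frobmul x + frobmul y.
Proof. by rewrite /frobmul map_mxD mulmxDl. Qed.

Lemma frobmul0 : frobmul 0 = 0.
Proof. by rewrite /frobmul map_mx0 mul0mx. Qed.

Lemma frobmul_sum I r (P : pred I) F :
  frobmul (\sum_(i <- r | P i) F i) = \sum_(i <- r | P i) frobmul (F i).
Proof.
exact: (big_morph frobmul frobmulD frobmul0).
Qed.

Section Coordinates.
Context (e : seq 'rV[K]_n) (free_e : free e).
Context (fix_e : {in e, forall x, frobmul x = x}).

(** Along fixed vectors the semilinear map is the Frobenius on each coordinate; fixed vectors thus
    have coordinates with [c^2 = c], that is, in [F_2]. *)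
Lemma frobmul_coord x : x \in <<e>>%VS -> frobmul x \in <<e>>%VS /\
  forall i : 'I_(size e), coord (in_tuple e) i (frobmul x) = coord (in_tuple e) i x ^+ 2.
Proof.
move=> xe.
have E : frobmul x = \sum_(i < size e) coord (in_tuple e) i x ^+ 2 *: e`_i.
  rewrite {1}(@coord_span _ _ _ (in_tuple e) x xe) frobmul_sum; apply: eq_bigr => i _.
  by rewrite frobmulZ fix_e // mem_nth.
split.
  by rewrite E memv_suml // => i _; rewrite memvZ // memv_span // mem_nth.
by move=> i; rewrite E (coord_sum_free _ _ (_ : free (in_tuple e))).
Qed.

Lemma frobmul_inj_span x : x \in <<e>>%VS -> frobmul x = 0 -> x = 0.
Proof.
move=> xe x0; have [_ cE] := frobmul_coord xe.
rewrite (@coord_span _ _ _ (in_tuple e) x xe) big1 // => i _.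
have := cE i; rewrite x0 linear0 => /esym/eqP; rewrite sqrf_eq0 => /eqP ->.
by rewrite scale0r.
Qed.

Lemma fixed_coord x : x \in <<e>>%VS -> frobmul x = x -> forall i,
  coord (in_tuple e) i x = (coord (in_tuple e) i x == 1)%:R.
Proof.
move=> xe xfix i; have [_ /(_ i)] := frobmul_coord xe.
rewrite xfix; set c := coord _ _ _ => /eqP.
rewrite -subr_eq0 expr2 -{1}[c]mulr1 -mulrBr mulf_eq0 subr_eq0.
by case/orP => /eqP => [->|<-]; rewrite ?eqxx // eq_sym oner_eq0.
Qed.

Lemma fixed_span_size s : uniq s -> {in s, forall x, frobmul x = x} ->
  {subset s <= <<e>>%VS} -> (size s <= 2 ^ size e)%N.
Proof.
move=> uniq_s fix_s sub_se.
pose f x := [ffun i => coord (in_tuple e) i x == 1].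
have inj_f : {in s &, injective f}.
  move=> x y xs ys /ffunP fxy.
  rewrite (@coord_span _ _ _ (in_tuple e) x (sub_se x xs)).
  rewrite (@coord_span _ _ _ (in_tuple e) y (sub_se y ys)).
  apply: eq_bigr => i _; rewrite fixed_coord ?fix_s ?sub_se //.
  by rewrite [in RHS]fixed_coord ?fix_s ?sub_se //; have := fxy i; rewrite !ffunE => ->.
have uniq_fs : uniq (map f s) by rewrite map_inj_in_uniq.
have <- : #|map f s| = size s by rewrite (card_uniqP uniq_fs) size_map.
by rewrite (leq_trans (max_card _)) // card_ffun card_bool card_ord.
Qed.

End Coordinates.
End Map.

(** The Frobenius images of [x] and [y] lie in the left kernel of [A], of dimension at most one; a
    square root of their ratio relates [x] and [y]. *)
Lemma frobmul_kernel n (A : 'M[K]_n) x y : (n <= (\rank A).+1)%N -> x != 0 ->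
  frobmul A x = 0 -> frobmul A y = 0 -> exists c, y = c *: x.
Proof.
move=> rkA nzx x0 y0.
have sub z : frobmul A z = 0 -> (map_mx frob z <= kermx A)%MS by move=> ?; apply/sub_kermxP.
have eqxK : (map_mx frob x == kermx A)%MS.
  rewrite -(geq_leqif (mxrank_leqif_eq (sub x x0))) mxrank_ker.
  by rewrite rank_rV map_mx_eq0 nzx leq_subLR addn1.
have : (map_mx frob y <= map_mx frob x)%MS by rewrite (eqmxP eqxK) sub.
case/sub_rVP=> c yE; have [d dE] := nth_root_exists c (isT : 0 < 2)%N.
exists d; apply: (map_mx_inj (f := frob)).
by rewrite map_mxZ yE /= pFrobenius_autE dE.
Qed.

(** The fixed vectors and 0 lie in the [F_2]-span of a free family [e] of fixed vectors, and the
    kernel holds at most one direction. If [e] has at most two members this allows [3 + 1] vectors;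
    if it has three, it is a basis, the map has no kernel, and [2^3 - 1] remain. *)
Lemma frobmul_directions_le7 (A : 'M[K]_3) (s : seq 'rV[K]_3) : (1 < \rank A)%N ->
  uniq s -> 0 \notin s ->
  {in s, forall x, frobmul A x = x \/ frobmul A x = 0} ->
  {in s &, forall x y c, y = c *: x -> x = y} -> (size s <= 7)%N.
Proof.
move=> rkA uniq_s s0 fix_s prop_s.
pose s1 := [seq x <- s | frobmul A x == x]; pose s2 := [seq x <- s | frobmul A x == 0].
have szs : (size s <= size s1 + size s2)%N.
  rewrite !size_filter -count_predUI; apply: leq_trans (leq_addr _ _).
  rewrite leq_eqVlt eq_sym -all_count; apply/orP; left.
  by apply/allP => x /fix_s[] E /=; rewrite E eqxx ?orbT.
have [e [sub_es free_e spanE]] := free_subset_span s1.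
have fix1 x : x \in s1 -> frobmul A x = x by rewrite mem_filter => /andP[/eqP].
have fix_e : {in e, forall x, frobmul A x = x} by move=> x /sub_es/fix1.
have sz1 : (size s1 < 2 ^ size e)%N.
  apply: (@fixed_span_size 3 A e free_e fix_e (0 :: s1)) => [|x|x].
  - by rewrite /= filter_uniq // andbT mem_filter (negbTE s0) andbF.
  - rewrite inE => /orP[/eqP ->|/fix1 //].
    exact: frobmul0.
  rewrite inE => /orP[/eqP ->|xs]; first exact: mem0v.
  by rewrite spanE memv_span.
have sz2 : (size s2 <= 1)%N.
  case E : s2 => [//|x [//|y t]].
  have: uniq s2 by rewrite filter_uniq.
  have: x \in s2 by rewrite E mem_head.
  have: y \in s2 by rewrite E !inE eqxx orbT.
  rewrite !mem_filter => /andP[/eqP y0 ys] /andP[/eqP x0 xs].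
  have nzx : x != 0 by apply: contraNneq s0 => <-.
  have [c yE] := @frobmul_kernel 3 A x y rkA nzx x0 y0.
  by rewrite E /= (prop_s x y xs ys c yE) inE eqxx.
have sze : (size e <= 3)%N.
  by rewrite -(eqP free_e) (leq_trans (dimvS (subvf _))) // dimvf /dim /= mul1n.
move: sze; rewrite leq_eqVlt => /orP[/eqP sze|sze]; last first.
  have : (2 ^ size e <= 4)%N by rewrite (leq_pexp2l _ (_ : _ <= 2)%N).
  move=> le4; apply: leq_trans szs _.
  by apply: (@leq_trans (3 + 1)) => //; rewrite leq_add // -ltnS (leq_trans sz1).
suff s20 : s2 = [::] by move: szs sz1; rewrite s20 addn0 sze ltnS; apply: leq_trans.
case E : s2 => [//|x t]; have: x \in s2 by rewrite E mem_head.
rewrite mem_filter => /andP[/eqP x0 xs].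
have : x = 0.
  apply: (@frobmul_inj_span 3 A e free_e fix_e) => //.
  suff -> : <<e>>%VS = fullv by apply: memvf.
  by apply/eqP; rewrite eqEdim subvf dimvf /dim /= mul1n (eqP free_e) sze.
by move=> xz; rewrite -xz xs in s0.
Qed.

Lemma span_mkseqP (vT : vectType K) (u : nat -> vT) r v :
  reflect (exists a : nat -> K, v = \sum_(i < r) a i *: u i)
          (v \in <<mkseq u r>>%VS).
Proof.
apply: (iffP idP) => [|[a ->]]; last first.
  rewrite memv_suml // => i _; rewrite memvZ // memv_span //.
  by rewrite map_f // mem_iota add0n ltn_ord.
elim: r v => [|r IH] v.
  rewrite span_nil memv0 => /eqP ->; exists (fun=> 0).
  by rewrite big_ord0.
rewrite /mkseq -addn1 iotaD map_cat span_cat span_seq1 add0n.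
case/memv_addP => w /IH[a ->] [w' /vlineP[c ->] ->].
exists (fun i => if i == r then c else a i); rewrite addn1 big_ord_recr /= eqxx.
congr (_ + _); apply: eq_bigr => i _.
by rewrite (ltn_eqF (ltn_ord i)).
Qed.

(** In finite dimension some term depends on its predecessors; for the least such [r] the terms
    before it are independent. *)
Lemma krylov_relation (vT : vectType K) (u : nat -> vT) : exists r,
  u r \in <<mkseq u r>>%VS /\ forall k, (k < r)%N -> u k \notin <<mkseq u k>>%VS.
Proof.
have [r ur] : exists r, u r \in <<mkseq u r>>%VS.
  apply/boolp.not_existsP => H.
  have fr k : free (mkseq u k).
    elim: k => [|k IH]; first by rewrite nil_free.
    rewrite mkseqS (@perm_free _ _ _ (u k :: mkseq u k)) ?perm_rcons //.
    by rewrite free_cons IH andbT; apply/negP/H.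
  have := dimvS (subvf <<mkseq u (\dim {:vT}).+1>>).
  by rewrite (eqP (fr _)) size_mkseq ltnn.
case: (ex_minnP (ex_intro (fun r => u r \in <<mkseq u r>>%VS) r ur)) => k uk mink.
exists k; split=> // l ltl; apply/negP => /mink.
by rewrite leqNgt ltl.
Qed.

(* [Q] is the quotient by ['X^2] of the polynomial in [T = c_(r-1)] giving
   [c_i] in the recursion [c_i = c_(i-1)^2 + a_i T^2] *)
Lemma frobenius_recursion (a : nat -> K) r : (exists2 i, (i < r)%N & a i != 0) ->
  exists c : nat -> K, [/\ c r.-1 != 0, c 0%N = a 0%N * c r.-1 ^+ 2 &
    forall i, c i.+1 = c i ^+ 2 + a i.+1 * c r.-1 ^+ 2].
Proof.
case=> i0 lt0 nz0.
pose Q := fix Q i : {poly K} :=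
  if i is j.+1 then 'X^2 * Q j ^+ 2 + (a i)%:P else (a 0%N)%:P.
have QS i : Q i.+1 = 'X^2 * Q i ^+ 2 + (a i.+1)%:P by [].
(* Once [Q i] is nonzero it stays so, since [X^2 Q_i^2] has positive degree and dominates the added
   constant. *)
have nzQ i : (i0 <= i)%N -> Q i != 0.
  elim: i => [|i IH].
    by rewrite leqn0 => /eqP i0E; rewrite /= polyC_eq0 -i0E.
  have [Qi0|nzQi] := eqVneq (Q i) 0.
    rewrite leq_eqVlt ltnS => /orP[/eqP i0E|/IH]; last by rewrite Qi0 eqxx.
    by rewrite QS Qi0 expr0n mulr0 add0r polyC_eq0 -i0E.
  move=> _; rewrite QS -size_poly_eq0 size_polyDl; last first.
    rewrite (leq_ltn_trans (size_polyC_leq1 _)) //.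
    by rewrite mulrC size_Mmonic ?monicXn ?expf_neq0 // size_polyXn addn3.
  by rewrite size_poly_eq0 mulf_neq0 ?expf_neq0 ?polyX_eq0 // -size_poly_eq0 size_polyXn.
have {}nzQ : Q r.-1 != 0 by apply: nzQ; rewrite -ltnS prednK // (leq_trans _ lt0).
(* With [c_i = T^2 Q_i(T)], the requirement [c_(r-1) = T] for nonzero [T] reads [T Q_(r-1)(T) = 1],
   solvable because [Q_(r-1)] is a nonzero polynomial. *)
have /closed_rootP[T] : size ('X * Q r.-1 - 1%:P : {poly K}) != 1%N.
  have sz : (1 < size ('X * Q r.-1)%R)%N.
    by rewrite mulrC size_mulX // ltnS lt0n size_poly_eq0.
  rewrite size_polyDl ?(gtn_eqF sz) //.
  by rewrite size_polyN (leq_ltn_trans (size_polyC_leq1 _)).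
rewrite /root !(hornerD, hornerN, hornerM, hornerX, hornerC) subr_eq0 => /eqP TQ.
have nzT : T != 0 by apply: contraTneq (oner_neq0 K) => T0; rewrite -TQ T0 mul0r eqxx.
exists (fun i => T ^+ 2 * (Q i).[T]).
have -> : T ^+ 2 * (Q r.-1).[T] = T by rewrite expr2 -mulrA TQ mulr1.
split=> // [|i]; first by rewrite /= hornerC mulrC.
by rewrite QS !(hornerD, hornerM, hornerX, hornerC); ring.
Qed.

(** Let [u_i] be the iterates of a nonzero vector and [u_r = sum a_i u_i] the first linear relation.
    Then [sum c_i u_i] is sent to [sum c_i^2 u_(i+1)], and eliminating [u_r] shows that it is fixed
    when the [c_i] satisfy the recursion of [frobenius_recursion]. *)
Lemma frobmul_fixed_exists n (A : 'M[K]_n.+1) : A \in unitmx ->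
  exists2 v, v != 0 & frobmul A v = v.
Proof.
move=> unitA.
have inj0 x : frobmul A x = 0 -> x = 0.
  move/(congr1 (mulmx^~ (invmx A))); rewrite mulmxK // mul0mx => /eqP.
  by rewrite map_mx_eq0 => /eqP.
pose u i := iter i (frobmul A) (const_mx 1).
have nzu i : u i != 0.
  elim: i => [|i IH]; last by apply: contra IH => /eqP/inj0/eqP.
  by apply/eqP => /rowP/(_ 0); rewrite !mxE => /eqP; rewrite oner_eq0.
have uS i : u i.+1 = frobmul A (u i) by [].
clearbody u; have [r [/span_mkseqP[a ur] min_r]] := krylov_relation u.
have r_gt0 : (0 < r)%N.
  rewrite lt0n; apply: contra (nzu r) => /eqP r0; move: ur.
  by rewrite r0 big_ord0 => ->.
have [|c [nzc c0 cS]] := @frobenius_recursion a r.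
  apply: boolp.contrapT => H; case/eqP: (nzu r); rewrite ur big1 // => i _.
  have [->|nz] := eqVneq (a i) 0; first by rewrite scale0r.
  by case: H; exists i.
case: r ur min_r r_gt0 nzc c0 cS => // r ur min_r _ /= nzc c0 cS.
exists (\sum_(i < r.+1) c i *: u i).
  (* The last coefficient is nonzero, so a vanishing sum would express [u r] through its
     predecessors, against minimality. *)
  apply/eqP; rewrite big_ord_recr /= => /eqP; rewrite addrC addr_eq0 => /eqP E.
  case/negP: (min_r r (ltnSn r)); apply/span_mkseqP.
  exists (fun i => - c i / c r); apply: (scalerI nzc); rewrite E scaler_sumr -sumrN.
  by apply: eq_bigr => i _; rewrite scalerA mulrC divfK // scaleNr.
rewrite frobmul_sum.
transitivity (\sum_(i < r.+1) c i ^+ 2 *: u i.+1).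
  by apply: eq_bigr => i _; rewrite frobmulZ uS.
rewrite big_ord_recr /= ur scaler_sumr [in RHS]big_ord_recl big_ord_recl /=.
rewrite scalerA mulrC -c0 addrCA; congr (_ + _).
rewrite -big_split /=; apply: eq_bigr => i _.
by rewrite /bump /= add1n cS scalerDl scalerA mulrC [a _ * _]mulrC.
Qed.

(* Lang's theorem for the general linear group and the Frobenius. *)
Theorem frobmul_fixed_basis n (A : 'M[K]_n) : A \in unitmx ->
  exists2 g : 'M[K]_n, g \in unitmx & map_mx frob g *m A = g.
Proof.
elim: n A => [|n IH] A unitA.
  by exists 1%:M; [rewrite unitmx1 | apply/matrixP => -[]].
have [v nzv vfix] := frobmul_fixed_exists unitA.
(* The fixed vector [v] is completed to a basis, the rows of [h]. *)
have [h unith hv] : exists2 h : 'M[K]_(1 + n), h \in unitmx & usubmx h = v.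
  have vE := mulmx_ebase v; rewrite rank_rV nzv /= in vE.
  have := col_ebase_unit v; rewrite [col_ebase v]mx11_scalar unitmxE det_scalar1 unitfE.
  set c := col_ebase v 0 0 => nzc.
  exists (c *: row_ebase v).
    by rewrite unitmxZ ?unitfE // row_ebase_unit.
  rewrite -[RHS]vE [col_ebase v]mx11_scalar -/c mul_scalar_mx -scalemxAl.
  rewrite linearZ /=; congr (_ *: _).
  rewrite (_ : pid_mx 1 = row_mx 1%:M 0); last exact: pid_mx_row.
  pose E : 'M[K]_(1 + n, 1 + n) := row_ebase v; rewrite -/E.
  transitivity (row_mx (1%:M : 'M[K]_1) (0 : 'M[K]_(1, n)) *m col_mx (usubmx E) (dsubmx E)).
    by rewrite mul_row_col mul1mx mul0mx addr0.
  by rewrite vsubmxK.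
(* The matrix of the semilinear map in the basis [h]; its first row is that of the identity because
   [v] is fixed. *)
pose B : 'M[K]_(1 + n) := map_mx frob h *m A *m invmx h.
have unith' : map_mx frob h \in unitmx by rewrite map_unitmx.
have unitB : B \in unitmx by rewrite !unitmx_mul unith' unitA unitmx_inv.
have Bu : usubmx B = row_mx 1%:M 0.
  rewrite /B -!mul_usub_mx -map_usubmx hv -/(frobmul A v) vfix -hv.
  by rewrite mul_usub_mx mulmxV // scalar_mx_block /block_mx col_mxKu.
have BE : B = block_mx 1%:M 0 (dlsubmx B) (drsubmx B).
  by rewrite -[LHS]vsubmxK Bu /block_mx hsubmxK.
have unitBr : drsubmx B \in unitmx.
  by move: unitB; rewrite BE !unitmxE det_lblock det1 mul1r block_mxKdr.
have [g unitg gfix] := IH _ unitBr.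
pose k := map_mx frob g *m dlsubmx B.
(* Artin-Schreier equations [c^2 - c + k = 0], one per coordinate, lift the fixed basis [g] of the
   quotient by [v] to fixed vectors. *)
have [c cE] : exists c : 'cV[K]_n, map_mx frob c + k = c.
  have /boolp.choice[c cE] : forall i : 'I_n, exists c, c ^+ 2 + k i 0 = c.
    move=> i; have [|t tE] := @quadratic_root K 1 (-1) (k i 0).
      by rewrite oppr_eq0 oner_eq0.
    exists t; apply/eqP; rewrite -subr_eq0 -tE; apply/eqP; ring.
  exists (\col_i c i); apply/colP => i.
  by rewrite !mxE pFrobenius_autE -[RHS]cE; congr (_ + _); rewrite mxE.
pose g1 : 'M[K]_(1 + n) := block_mx 1%:M 0 c g.
have g1fix : map_mx frob g1 *m B = g1.
  rewrite BE /g1 map_block_mx map_mx1 map_mx0 mulmx_block.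
  by rewrite !(mul1mx, mul0mx, mulmx0, mulmx1, addr0, add0r) gfix cE.
have unitg1 : g1 \in unitmx by rewrite unitmxE det_lblock det1 mul1r -unitmxE.
exists (g1 *m h); first by rewrite unitmx_mul unitg1.
by rewrite map_mxM -[in RHS]g1fix /B -!mulmxA mulVmx // mulmx1.
Qed.

End FrobeniusLinear.

(** * Ring morphisms out of polynomial rings *)

Section PolynomialMorphisms.
Context (n : nat) (R : comNzRingType).

Lemma mpoly_ring_ind (P : {mpoly R[n]} -> Prop) :
  (forall c, P c%:MP) -> (forall i, P 'X_i) ->
  (forall p q, P p -> P q -> P (p + q)) -> (forall p q, P p -> P q -> P (p * q)) ->
  forall p, P p.
Proof.
move=> PC PX PD PM; elim/mpolyind => [|c m p _ _ Pp].
  by rewrite -mpolyC0; apply: PC.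
apply: PD => //; rewrite -mul_mpolyC; apply: (PM) => //.
rewrite mpolyXE_id; elim/big_rec: _ => [|i q _ Pq]; first by rewrite -mpolyC1; apply: PC.
apply: (PM) => //; elim: (m i) => [|k IH]; first by rewrite expr0 -mpolyC1; apply: PC.
by rewrite exprS; apply: (PM).
Qed.

Lemma mpoly_rmorphism_ext (S : comNzRingType) (f g : {rmorphism {mpoly R[n]} -> S}) :
  (forall c, f c%:MP = g c%:MP) -> (forall i, f 'X_i = g 'X_i) -> f =1 g.
Proof.
move=> fgC fgX; apply: mpoly_ring_ind => // p q fp fq.
  by rewrite !rmorphD fp fq.
by rewrite !rmorphM fp fq.
Qed.

End PolynomialMorphisms.

(** * Quartics in characteristic 2 *)

Section QuarticForm.
Context (K : closedFieldType) (charK : 2%N \in [pchar K]).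
Local Notation frob := (pFrobenius_aut charK).
Implicit Types (M : 'M[K]_3) (Q : {mpoly K[3]}).

Lemma mpoly2_eq0 n : 2%:R = 0 :> {mpoly K[n]}.
Proof. by rewrite -scaler_nat (pcharf0 charK) scale0r. Qed.

Lemma mpoly_sqrrD n (p q : {mpoly K[n]}) : (p + q) ^+ 2 = p ^+ 2 + q ^+ 2.
Proof. by rewrite sqrrD -mulr_natl mpoly2_eq0 mul0r addr0. Qed.

Definition linear_form M (i : 'I_3) : {mpoly K[3]} := \sum_j M i j *: 'X_j.

(* Every quartic in characteristic 2 is a combination of squares with the
   square-free monomials of even degree as coefficients. *)
Definition quartic_form Q M : {mpoly K[3]} :=
  Q ^+ 2 + 'X_(inord 1) * 'X_(inord 2) * linear_form M (inord 0) ^+ 2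
  + 'X_(inord 0) * 'X_(inord 2) * linear_form M (inord 1) ^+ 2
  + 'X_(inord 0) * 'X_(inord 1) * linear_form M (inord 2) ^+ 2.

Lemma linear_formD M M' i : linear_form (M + M') i = linear_form M i + linear_form M' i.
Proof.
rewrite /linear_form -big_split /=; apply: eq_bigr => j _.
by rewrite mxE scalerDl.
Qed.

Lemma quartic_formD Q Q' M M' :
  quartic_form (Q + Q') (M + M') = quartic_form Q M + quartic_form Q' M'.
Proof. by rewrite /quartic_form !linear_formD !mpoly_sqrrD; ring. Qed.

Lemma linear_form0 i : linear_form 0 i = 0.
Proof. by rewrite /linear_form big1 // => j _; rewrite mxE scale0r. Qed.

Lemma linear_form_delta i j c i' : 
  linear_form (c *: delta_mx i j) i' = if i' == i then c *: 'X_j else 0.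
Proof.
rewrite /linear_form (bigD1 j) //= !mxE eqxx andbT big1 => [|k neq].
  by case: eqP => _; rewrite addr0 ?mulr1 // mulr0 scale0r.
by rewrite !mxE (negbTE neq) andbF mulr0 scale0r.
Qed.

(** As the degree is even, either no exponent or exactly two exponents are odd. Extracting the odd
    variables leaves the square of a monomial of degree 2 or 1, and the coefficient has a square
    root. The first case is absorbed by [Q], the second by one entry of [M]. *)
Lemma quartic_form_monomial c (m : 'X_{1..3}) : mdeg m = 4%N ->
  exists Q M, c *: 'X_[m] = quartic_form Q M.
Proof.
move=> deg_m; have [s sE] := nth_root_exists c (isT : 0 < 2)%N.
pose m' : 'X_{1..3} := [multinom (m i)./2 | i < 3].
have XmE : c *: 'X_[m] = 'X_(inord 0) ^+ odd (m (inord 0)) * 'X_(inord 1) ^+ odd (m (inord 1))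
   * 'X_(inord 2) ^+ odd (m (inord 2)) * (s *: 'X_[m']) ^+ 2.
  have X3 (F : 'I_3 -> {mpoly K[3]}) : \prod_i F i = F (inord 0) * F (inord 1) * F (inord 2).
    rewrite !big_ord_recl big_ord0 mulr1 mulrA.
    by congr (F _ * F _ * F _); apply: val_inj; rewrite /= inordK.
  rewrite exprZn sE -!scalerAr; congr (_ *: _).
  rewrite (mpolyXE_id _ m) (mpolyXE_id _ m') !X3 !mnmE.
  have sq (x : {mpoly K[3]}) k : x ^+ k = x ^+ odd k * (x ^+ k./2) ^+ 2.
    by rewrite -exprM -exprD muln2 odd_double_half.
  rewrite (sq _ (m (inord 0))) (sq _ (m (inord 1))) (sq _ (m (inord 2))); ring.
have deg3 : (m (inord 0) + m (inord 1) + m (inord 2) = 4)%N.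
  rewrite -deg_m mdegE !big_ord_recl big_ord0 addn0 addnA.
  by congr (m _ + m _ + m _)%N; apply: val_inj; rewrite /= inordK.
have degm' : (odd (m (inord 0)) + odd (m (inord 1)) + odd (m (inord 2)) + (mdeg m').*2 = 4)%N.
  have -> : mdeg m' = ((m (inord 0))./2 + (m (inord 1))./2 + (m (inord 2))./2)%N.
    rewrite mdegE !big_ord_recl big_ord0 addn0 addnA !mnmE.
    by congr ((m _)./2 + (m _)./2 + (m _)./2)%N; apply: val_inj; rewrite /= inordK.
  have := odd_double_half (m (inord 0)); have := odd_double_half (m (inord 1)).
  have := odd_double_half (m (inord 2)); lia.
have form_delta i j : (i < 3)%N -> quartic_form 0 (s *: delta_mx (inord i) j) =
   nth 0 [:: 'X_(inord 1) * 'X_(inord 2); 'X_(inord 0) * 'X_(inord 2);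
             'X_(inord 0) * 'X_(inord 1)] i * (s *: 'X_j) ^+ 2.
  rewrite /quartic_form !linear_form_delta -!val_eqE /=.
  by case: i => [|[|[|//]]] _; rewrite !inordK //=; ring.
rewrite XmE; move: degm'.
have j_of : mdeg m' = 1%N -> exists j, 'X_[m'] = 'X_j :> {mpoly K[3]}.
  by move/eqP/mdeg1P => [j /eqP ->]; exists j.
case: (odd (m (inord 0))); case: (odd (m (inord 1))); case: (odd (m (inord 2))) => /= degm'.
- by move/(congr1 odd): degm'; rewrite oddD odd_double.
- case: j_of => [|j ->]; first by case: (mdeg m') degm' => [|[|]].
  by exists 0, (s *: delta_mx (inord 2) j); rewrite form_delta //=; ring.
- case: j_of => [|j ->]; first by case: (mdeg m') degm' => [|[|]].
  by exists 0, (s *: delta_mx (inord 1) j); rewrite form_delta //=; ring.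
- by move/(congr1 odd): degm'; rewrite oddD odd_double.
- case: j_of => [|j ->]; first by case: (mdeg m') degm' => [|[|]].
  by exists 0, (s *: delta_mx (inord 0) j); rewrite form_delta //=; ring.
- by move/(congr1 odd): degm'; rewrite oddD odd_double.
- by move/(congr1 odd): degm'; rewrite oddD odd_double.
exists (s *: 'X_[m']), 0; rewrite /quartic_form !linear_form0; ring.
Qed.

Lemma quartic_formP (B : dhomog 3 K 4) : exists Q M, val B = quartic_form Q M.
Proof.
have Bhom : val B \is 4.-homog by apply: dhomog_is_dhomog.
rewrite [val B]mpolyE big_seq.
elim/big_ind: _ => [|p q [Q [M ->]] [Q' [M' ->]]|m mB].
- exists 0, 0; rewrite /quartic_form !linear_form0; ring.
- by exists (Q + Q'), (M + M'); rewrite quartic_formD.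
by apply: quartic_form_monomial; apply: (dhomogP _ _ _ Bhom).
Qed.

End QuarticForm.

(** * Partial derivatives of the quartic and its Hessian matrix *)

Section SingularPoints.
Context (K : closedFieldType) (charK : 2%N \in [pchar K]).
Local Notation frob := (pFrobenius_aut charK).
Local Notation widen i := (widen_ord (leqnSn 3) i).
Implicit Types (M : 'M[K]_3) (Q : {mpoly K[3]}) (v : 'rV[K]_4) (x y : 'rV[K]_3).

Lemma mderiv_sqr n (k : 'I_n) (p : {mpoly K[n]}) : (p ^+ 2)^`M(k) = 0.
Proof.
have -> : p ^+ 2 = p * p by [].
by rewrite mderivM mulrC -mulr2n -mulr_natl (mpoly2_eq0 charK) mul0r.
Qed.

Lemma mderivM_sqr n (k : 'I_n) (p q : {mpoly K[n]}) :
  (p * q ^+ 2)^`M(k) = p^`M(k) * q ^+ 2.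
Proof. by rewrite mderivM mderiv_sqr mulr0 addr0. Qed.

Lemma mderivXU n (k i : 'I_n) : ('X_i : {mpoly K[n]})^`M(k) = (i == k)%:R.
Proof.
rewrite mderivX mnm1E; case: eqP => [->|_]; last by rewrite scale0r.
by rewrite scale1r (_ : (_ - _)%MM = 0%MM) ?mpolyX0 //; apply/mnmP => j; rewrite !mnmE subnn.
Qed.

Lemma mderiv_nat n (k : 'I_n) m : (m%:R : {mpoly K[n]})^`M(k) = 0.
Proof. by rewrite -mpolyC_nat mderivC. Qed.

Lemma meval_dhomog n d (p : {mpoly K[n]}) c (x : 'I_n -> K) : p \is d.-homog ->
  p.@[fun i => c * x i] = c ^+ d * p.@[x].
Proof.
move=> /dhomogP hom_p; rewrite !mevalE mulr_sumr big_seq [in RHS]big_seq.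
apply: eq_bigr => m /hom_p /= <-; rewrite mulrCA; congr (_ * _).
rewrite mdegE -prodrXr -big_split /=; apply: eq_bigr => i _.
by rewrite exprMn.
Qed.

(** Differentiating by the two variables other than [x_i] isolates [L_i^2] in a [quartic_form], and
    its value at the [j]-th unit vector is the square of [M i j]. Unlike [M], this matrix depends
    linearly on [B]. *)
Definition hessian_mx (B : {mpoly K[3]}) : 'M[K]_3 := \matrix_(j, i)
  (B^`M(inord ((i + 1) %% 3))^`M(inord ((i + 2) %% 3))).@[fun k => (k == j)%:R].

Lemma linear_form_meval M i x :
  (linear_form M i).@[x 0] = \sum_j M i j * x 0 j.
Proof.
rewrite /linear_form raddf_sum /=; apply: eq_bigr => j _.
by rewrite mevalZ mevalXU.
Qed.

(** Vectors are rows, hence the transpose; applying the Frobenius to the entries as well makes the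
    product the square of [L_i]. *)
Lemma frobmul_linear_form M x i :
  frobmul charK (map_mx frob M^T) x 0 i = (linear_form M i).@[x 0] ^+ 2.
Proof.
rewrite /frobmul -map_mxM mxE /= pFrobenius_autE mxE linear_form_meval; congr (_ ^+ 2).
by apply: eq_bigr => j _; rewrite mxE mulrC.
Qed.

Lemma forall_ord3 (P : 'I_3 -> Prop) : P (inord 0) -> P (inord 1) -> P (inord 2) -> forall i, P i.
Proof.
move=> P0 P1 P2 [[|[|[|//]]] lti]; move: P0 P1 P2.
- by rewrite (_ : inord 0 = Ordinal lti) //; apply: val_inj; rewrite /= inordK.
- by rewrite (_ : inord 1 = Ordinal lti) //; apply: val_inj; rewrite /= inordK.
by rewrite (_ : inord 2 = Ordinal lti) //; apply: val_inj; rewrite /= inordK.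
Qed.

Lemma hessian_form Q M : hessian_mx (quartic_form Q M) = map_mx frob M^T.
Proof.
apply/matrixP => j i; rewrite !mxE /= pFrobenius_autE.
have -> : M i j = (linear_form M i).@[fun k => (k == j)%:R].
  rewrite /linear_form raddf_sum /= (bigD1 j) //= mevalZ mevalXU eqxx mulr1.
  rewrite big1 ?addr0 // => k neq.
  by rewrite mevalZ mevalXU (negbTE neq) mulr0.
rewrite -rmorphXn; congr (_.@[_]).
rewrite /quartic_form !(mderivD, mderivM_sqr, mderiv_sqr, mderivM, mderivXU, mderiv_nat).
by move: i; apply: forall_ord3; rewrite !inordK // -!val_eqE /= !inordK //=;
  rewrite ?(mul0r, mul1r, mulr0, mulr1, addr0, add0r) mderiv0 add0r.
Qed.

(** The coordinates of the cross product, whose signs disappear in characteristic 2. *)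
Definition cross_zero x y := [/\ x 0 (inord 1) * y 0 (inord 2) + x 0 (inord 2) * y 0 (inord 1) = 0,
  x 0 (inord 0) * y 0 (inord 2) + x 0 (inord 2) * y 0 (inord 0) = 0 &
  x 0 (inord 0) * y 0 (inord 1) + x 0 (inord 1) * y 0 (inord 0) = 0].

Lemma cross_zeroP x y : x != 0 -> cross_zero x y <-> exists c, y = c *: x.
Proof.
have add0 (a b : K) : a + b = 0 <-> a = b.
  rewrite -(GRing.subr_pchar2 charK); split => [/eqP|->]; last by rewrite subrr.
  by rewrite subr_eq0 => /eqP.
move=> nzx; split=> [[/add0 C0 /add0 C1 /add0 C2]|[c ->]]; last first.
  by split; apply/add0; rewrite !mxE; ring.
have [i nzi] : exists i, x 0 i != 0 by apply/rV0Pn.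
exists (y 0 i / x 0 i); apply/rowP => j; rewrite !mxE.
apply: (mulfI nzi); have -> : x 0 i * (y 0 i / x 0 i * x 0 j) = x 0 j * y 0 i by field.
by move: i j {nzi}; do 2!apply: forall_ord3; rewrite // mulrC.
Qed.

Definition base_point v : 'rV[K]_3 := \row_i v 0 (widen i).

Lemma meval_mwiden p v : (mwiden p).@[v 0] = p.@[base_point v 0].
Proof.
pose f : {rmorphism {mpoly K[3]} -> K} := meval (v 0) \o @mwiden 3 K.
apply: (@mpoly_rmorphism_ext 3 K K f (meval (base_point v 0))) => [c|i] /=.
  by rewrite mwidenC !mevalC.
by rewrite mwidenX mnmwiden1 !mevalXU mxE.
Qed.

Lemma quartic_formE Q M : quartic (quartic_form Q M) = ('X_ord_max ^+ 2) ^+ 2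
  + mwiden Q ^+ 2
  + 'X_(widen (inord 1)) * 'X_(widen (inord 2)) * mwiden (linear_form M (inord 0)) ^+ 2
  + 'X_(widen (inord 0)) * 'X_(widen (inord 2)) * mwiden (linear_form M (inord 1)) ^+ 2
  + 'X_(widen (inord 0)) * 'X_(widen (inord 1)) * mwiden (linear_form M (inord 2)) ^+ 2.
Proof.
have wX i : mwiden 'X_i = 'X_(widen i) :> {mpoly K[4]} by rewrite mwidenX mnmwiden1.
rewrite /quartic /quartic_form -exprM !mwidenD !mwidenM !wX !addrA.
by [].
Qed.

Lemma meval_quartic B v : (quartic B).@[v 0] = v 0 ord_max ^+ 4 + B.@[base_point v 0].
Proof. by rewrite /quartic mevalD meval_mwiden rmorphXn /= mevalXU. Qed.

(** Squares have zero derivative, so the derivative by [z] vanishes and the others are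
    [x_j L_k^2 + x_k L_j^2], the coordinates of the cross product of [x] with its image. *)
Lemma mderiv_quartic_formP Q M v :
  (forall i, ((quartic (quartic_form Q M))^`M(i)).@[v 0] = 0) <->
  cross_zero (base_point v) (frobmul charK (map_mx frob M^T) (base_point v)).
Proof.
pose E i : {mpoly K[4]} := (quartic (quartic_form Q M))^`M(i).
pose l k := (linear_form M (inord k)).@[base_point v 0].
pose X k := base_point v 0 (inord k).
have dE i : (E i).@[v 0] =
  ((widen (inord 1) == i)%:R * X 2 + X 1 * (widen (inord 2) == i)%:R) * l 0%N ^+ 2
  + ((widen (inord 0) == i)%:R * X 2 + X 0%N * (widen (inord 2) == i)%:R) * l 1%N ^+ 2
  + ((widen (inord 0) == i)%:R * X 1%N + X 0%N * (widen (inord 1) == i)%:R) * l 2%N ^+ 2.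
  rewrite /E quartic_formE !(mderivD, mderivM_sqr, mderiv_sqr, mderivM, mderivXU).
  rewrite mul0r !add0r !(mevalD, mevalM, mevalXU, meval0) !meval_mwiden.
  by rewrite /X !mxE !rmorph_nat.
rewrite /cross_zero !frobmul_linear_form -!/(X _) -!/(l _).
split=> [H|[C0 C1 C2] i].
  have := dE (widen (inord 0)); have := dE (widen (inord 1)); have := dE (widen (inord 2)).
  rewrite /E !H -!val_eqE /= !inordK //= => h2 h1 h0.
  by split; [rewrite [RHS]h0 | rewrite [RHS]h1 | rewrite [RHS]h2]; ring.
rewrite -/(E i) dE -!val_eqE /= !inordK //.
case: i => -[|[|[|[|//]]]] lti /=; last by ring.
- by rewrite -[RHS]C0; ring.
- by rewrite -[RHS]C1; ring.
- by rewrite -[RHS]C2; ring.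
Qed.

End SingularPoints.

(** * Failure of normality *)

Section NonNormal.
Context (K : closedFieldType) (charK : 2%N \in [pchar K]).
Local Notation widen i := (widen_ord (leqnSn 3) i).

Lemma lift_widen_max (i : 'I_3) : exists k, lift (widen i) k = ord_max.
Proof.
have : widen i != ord_max by rewrite -val_eqE /= ltn_eqF.
by case/unlift_some => k -> _; exists k.
Qed.

Lemma square_div_add (F : fieldType) (a b t : F) :
  b != 0 -> a ^+ 2 + b ^+ 2 * t = 0 -> (a / b) ^+ 2 + t = 0.
Proof.
move=> nzb E; have -> : (a / b) ^+ 2 + t = (a ^+ 2 + b ^+ 2 * t) / b ^+ 2 by field.
by rewrite E mul0r.
Qed.

(** For [b != 0] the fraction [a / b] is a root of the monic polynomial [X^2 + t], hence
    integral. *)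
Lemma integrally_closed_sqr (R : idomainType) (a b t : R) :
  integrally_closed R -> a ^+ 2 + b ^+ 2 * t = 0 -> exists r, a = b * r.
Proof.
move=> closedR abt; have [b0|nzb] := eqVneq b 0.
  exists 0; rewrite mulr0; apply/eqP; move/eqP: abt.
  by rewrite b0 expr0n mul0r addr0 sqrf_eq0.
have nzFb : tofrac b != 0 by rewrite tofrac_eq0.
have [|r rE] := closedR (tofrac a / tofrac b).
  exists ('X^2 + t%:P).
    by rewrite monicE lead_coefDl ?lead_coefXn // size_polyXn (leq_ltn_trans (size_polyC_leq1 _)).
  rewrite /root rmorphD rmorphXn /= map_polyX map_polyC hornerD hornerXn hornerC /=.
  apply/eqP/square_div_add => //.
  by rewrite -!rmorphXn -rmorphM -rmorphD abt rmorph0.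
have abrE : tofrac a = tofrac (b * r).
  rewrite rmorphM -[LHS](divfK nzFb) mulrC.
  by congr (_ * _).
by exists r; apply/eqP; rewrite -tofrac_eq; apply/eqP.
Qed.

(* At a point where [l] vanishes, [(z^2 + Q) / l] is a square root of [T],
   hence integral, but does not belong to the local ring. *)
Lemma not_normal (B Q l T : {mpoly K[3]}) (x : 'rV[K]_3) (i : 'I_3) :
  B = Q ^+ 2 + l ^+ 2 * T -> l.@[x 0] = 0 -> x 0 i = 1 ->
  ~ normal_hypersurface (quartic B).
Proof.
move=> BE lx xi normB.
pose lp : 4.-tuple {mpoly K[3]} :=
  [tuple if unlift (widen i) j is Some k then 'X_k else 1 | j < 4].
pose s : {rmorphism {mpoly K[4]} -> {mpoly K[3]}} := comp_mpoly lp.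
have [kz kzE] := lift_widen_max i.
have sC c : s c%:MP = c%:MP by rewrite /s /= comp_mpolyC.
have sX j : s 'X_j = if unlift (widen i) j is Some k then 'X_k else 1.
  by rewrite /s /= comp_mpolyXU -tnth_nth tnth_mktuple.
(* Restriction to the line over [x] in the chart: the base coordinates become constants and [z]
   becomes the variable. *)
pose rho : {rmorphism {mpoly K[3]} -> {poly K}} := mmap (@polyC K)
  (fun k => if unlift ord_max (lift (widen i) k) is Some j then (x 0 j)%:P else 'X).
have rhoC c : rho c%:MP = c%:P by rewrite /rho /= mmapC.
have rhoX k : rho 'X_k = if unlift ord_max (lift (widen i) k) is Some j then (x 0 j)%:P else 'X.
  by rewrite /rho /= mmapX mmap1U.
have unlift_widen j : unlift ord_max (widen j) = Some j.
  have -> : widen j = lift ord_max j by apply/val_inj/esym/lift_max.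
  exact: liftK.
have rhos p : rho (s (mwiden p)) = (p.@[x 0])%:P.
  pose f : {rmorphism {mpoly K[3]} -> {poly K}} := rho \o s \o @mwiden 3 K.
  pose g : {rmorphism {mpoly K[3]} -> {poly K}} := @polyC K \o meval (x 0).
  apply: (@mpoly_rmorphism_ext 3 K _ f g) => [c|j]; rewrite /f /g /=.
    by rewrite mwidenC sC rhoC mevalC.
  rewrite mwidenX mnmwiden1 mevalXU sX.
  case: unliftP => [k kE|/eqP]; first by rewrite rhoX -kE unlift_widen.
  by rewrite -val_eqE /= => /eqP/val_inj ->; rewrite rmorph1 xi.
have sZ : s 'X_ord_max = 'X_kz by rewrite sX -kzE liftK.
have rhoZ : rho 'X_kz = 'X by rewrite rhoX kzE unlift_none.
(* With this square root, [z^2 + Q] vanishes at the point [z = z0] of the line; [q] will be the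
   maximal ideal of that point. *)
have [z0 z0E] := nth_root_exists (Q.@[x 0]) (isT : 0 < 2)%N.
have chE : chart_eq (quartic B) (widen i) = s (quartic B) by [].
clearbody s rho.
pose psi p := (rho p).[z0].
have psiD p q : psi (p + q) = psi p + psi q by rewrite /psi rmorphD hornerD.
have psiM p q : psi (p * q) = psi p * psi q by rewrite /psi rmorphM hornerM.
have psi1 : psi 1 = 1 by rewrite /psi rmorph1 hornerC.
pose q : {pred {mpoly K[3]}} := [pred p | psi p == 0].
have qE p : (p \in q) = (psi p == 0) by [].
pose h := s ('X_ord_max ^+ 2 + mwiden Q); pose g := s (mwiden l); pose t := s (mwiden T).
have fE : chart_eq (quartic B) (widen i) = h ^+ 2 + g ^+ 2 * t.
  rewrite chE /quartic BE /h /g /t.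
  by rewrite !(rmorphD, rmorphM, rmorphXn) /= (mpoly_sqrrD charK); ring.
have rhoh : rho h = 'X^2 + (Q.@[x 0])%:P.
  by rewrite /h rmorphD rmorphXn /= sZ rmorphD rmorphXn rhoZ rhos.
have rhog : rho g = 0 by rewrite /g rhos lx.
clearbody h g t.
have psih : psi h = 0.
  rewrite /psi rhoh hornerD hornerXn hornerC z0E.
  exact: (addrr_pchar2 charK).
have fq : h ^+ 2 + g ^+ 2 * t \in q.
  by rewrite qE psiD !psiM psih /psi rhog horner0 !mul0r addr0.
have idealq : idealr_closed q.
  split=> [||a u v]; rewrite ?qE.
  + by rewrite /psi rmorph0 horner0.
  + by rewrite psi1 oner_eq0.
  + by rewrite psiD psiM => /eqP -> /eqP ->; rewrite mulr0 addr0.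
have primeq : prime_idealr_closed q by move=> u v; rewrite !qE psiM mulf_eq0.
rewrite -fE in fq.
have [R [phi [[phiU phiF phi0] closedR]]] := normB (widen i) q idealq primeq fq.
have phif : phi h ^+ 2 + phi g ^+ 2 * phi t = 0.
  transitivity (phi (chart_eq (quartic B) (widen i))).
    by rewrite fE rmorphD rmorphXn rmorphM rmorphXn.
  by apply/phi0; exists 1, 1; rewrite qE psi1 oner_eq0.
have [r rE] := integrally_closed_sqr closedR phif.
have [a [d [dq rE']]] := phiF r.
(* Clearing denominators in [h = g a / d] and restricting to the line, where [g] is zero and [h] is
   not, leaves [c d = e h]; at [z0] this forces [c] or [d] into [q]. *)
have : phi (h * d - g * a) = 0.
  rewrite rmorphB !rmorphM /= rE -mulrA rE' divrK ?subrr //.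
  exact: phiU.
case/phi0 => c [e [cq]]; rewrite fE => /(congr1 rho).
rewrite !(rmorphM, rmorphB, rmorphD, rmorphXn) /= rhog.
move=> E; have {E} /eqP : rho h * (rho c * rho d - rho e * rho h) = 0.
  by rewrite -[RHS](subrr (rho e * (rho h ^+ 2 + 0 ^+ 2 * rho t))) -[X in _ = X - _]E; ring.
rewrite mulf_eq0 => /orP[|].
  rewrite rhoh -size_poly_eq0 size_polyDl size_polyXn //.
  exact: leq_ltn_trans (size_polyC_leq1 _) _.
rewrite subr_eq0 => /eqP/(congr1 (fun p => p.[z0])).
rewrite !hornerM -/(psi c) -/(psi d) -/(psi h) psih mulr0 => /eqP.
by rewrite mulf_eq0 -!qE (negbTE cq) (negbTE dq).
Qed.

End NonNormal.

(** * Local equation at a singular point *)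

Section A3Points.
Context (K : closedFieldType) (charK : 2%N \in [pchar K]).
Local Notation frob := (pFrobenius_aut charK).
Local Notation widen i := (widen_ord (leqnSn 3) i).
Implicit Types (M : 'M[K]_3) (Q : {mpoly K[3]}) (v : 'rV[K]_4).
Local Notation X0 := ('X_(inord 0) : {mpoly K[3]}).
Local Notation X1 := ('X_(inord 1) : {mpoly K[3]}).
Local Notation X2 := ('X_(inord 2) : {mpoly K[3]}).

Lemma rmorph_sum_squares (R S : comNzRingType) (f : {rmorphism R -> S})
    (z q a b c l m n : R) :
  f ((z ^+ 2) ^+ 2 + q ^+ 2 + b * c * l ^+ 2 + a * c * m ^+ 2 + a * b * n ^+ 2) =
  (f z ^+ 2) ^+ 2 + f q ^+ 2 + f b * f c * f l ^+ 2 + f a * f c * f m ^+ 2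
    + f a * f b * f n ^+ 2.
Proof. by rewrite !(rmorphD, rmorphM). Qed.

(** Write a nearby point as [x + d]. As [L_i(x)^2 = mu x_i], every term linear in the [d_k] occurs
    twice and cancels. The mixed quadratic part is [mu (x_0 d_1 d_2 + x_1 d_0 d_2 + x_2 d_0 d_1)],
    of which the chart keeps one term, with coefficient [mu]. Apart from [z^4], the rest is a
    combination of squares of the other two coordinates. *)
Lemma quartic_chart_A3 Q M v mu (i : 'I_3) (F := quartic (quartic_form Q M)) :
  mu != 0 -> v 0 (widen i) = 1 -> F.@[v 0] = 0 ->
  frobmul charK (map_mx frob M^T) (base_point v) = mu *: base_point v ->
  formally_equivalent
    (series_of_mpoly (translate (chart_eq F (widen i)) (fun k => v 0 (lift (widen i) k))))
    (series_of_mpoly (A_equation K 3)).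
Proof.
move=> nz_mu vi Fv eigen.
pose tr : {rmorphism {mpoly K[3]} -> {mpoly K[3]}} :=
  comp_mpoly [tuple 'X_k + (v 0 (lift (widen i) k))%:MP | k < 3].
pose ch : {rmorphism {mpoly K[4]} -> {mpoly K[3]}} :=
  comp_mpoly [tuple if unlift (widen i) j is Some k then 'X_k else 1 | j < 4].
pose rho : {rmorphism {mpoly K[4]} -> {mpoly K[3]}} := tr \o ch.
have rhoC c : rho c%:MP = c%:MP by rewrite /rho /= !comp_mpolyC.
have rhoi : rho 'X_(widen i) = 1.
  by rewrite /rho /= comp_mpolyXU -tnth_nth tnth_mktuple unlift_none rmorph1.
have rhoX k : rho 'X_(lift (widen i) k) = 'X_k + (v 0 (lift (widen i) k))%:MP.
  by rewrite /rho /= comp_mpolyXU -tnth_nth tnth_mktuple liftK comp_mpolyXU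
    -tnth_nth tnth_mktuple.
rewrite -[translate _ _]/(rho F); 
have rho0 p : (rho p).@[fun=> 0] = p.@[v 0].
  pose f : {rmorphism {mpoly K[4]} -> K} := meval (fun=> 0) \o rho.
  apply: (@mpoly_rmorphism_ext 4 K K f (meval (v 0))) => [c|j]; rewrite /f /=.
    by rewrite [comp_mpoly _ _]rhoC !mevalC.
  rewrite mevalXU; have [k ->|->] := unliftP (widen i) j.
    by rewrite [comp_mpoly _ _]rhoX mevalD mevalXU mevalC add0r.
  by rewrite [comp_mpoly _ _]rhoi meval1 vi.
clearbody rho; clear tr ch.
pose x k : {mpoly K[3]} := (v 0 (widen (inord k)))%:MP.
pose d k := rho 'X_(widen (inord k)) - x k.
have rhod k : rho 'X_(widen (inord k)) = x k + d k by rewrite /d addrC subrK.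
pose c := (v 0 ord_max)%:MP : {mpoly K[3]}.
have rhoZ : rho 'X_ord_max = X2 + c.
  have liftZ : lift (widen i) (inord 2) = ord_max.
    by apply: val_inj; rewrite /= inordK // /bump -ltnS ltn_ord.
  by rewrite -[in LHS]liftZ rhoX liftZ.
have d_lift l j : (l < 3)%N -> (j < 3)%N -> bump i l = j -> d j = 'X_(inord l).
  move=> l3 j3 E; have liftE : lift (widen i) (inord l) = widen (inord j).
    by apply: val_inj; rewrite /= !inordK.
  by rewrite /d -liftE rhoX liftE addrK.
have d_i j : i = inord j -> d j = 0 /\ x j = 1.
  by move=> E; rewrite /d /x -E rhoi vi mpolyC1 subrr.
(* In the chart one base coordinate is 1 with increment 0, and the other two increments are [X0] and
   [X1]. *)
have dE : [\/ [/\ d 0%N = 0, x 0%N = 1, d 1%N = X0 & d 2 = X1],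
    [/\ d 1%N = 0, x 1%N = 1, d 0%N = X0 & d 2 = X1] |
    [/\ d 2 = 0, x 2 = 1, d 0%N = X0 & d 1%N = X1]].
  have [E|E|E] : [\/ i = inord 0, i = inord 1 | i = inord 2].
  - by move: (i); apply: forall_ord3; [constructor 1|constructor 2|constructor 3].
  - have [d0 x0] := d_i 0%N E; constructor 1.
    by split=> //; apply: d_lift => //; rewrite E inordK.
  - have [d0 x0] := d_i 1%N E; constructor 2.
    by split=> //; apply: d_lift => //; rewrite E inordK.
  - have [d0 x0] := d_i 2 E; constructor 3.
    by split=> //; apply: d_lift => //; rewrite E inordK.
clear d_lift d_i; clearbody d.
pose m k j : {mpoly K[3]} := (M (inord k) (inord j))%:MP.
have rho_lin k : rho (mwiden (linear_form M (inord k))) =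
    ((linear_form M (inord k)).@[base_point v 0])%:MP
      + (m k 0%N * d 0%N + m k 1%N * d 1%N + m k 2 * d 2).
  rewrite linear_form_meval /linear_form !sum_ord3 !mwidenD !mwidenZ !mwidenX !mnmwiden1.
  rewrite !rmorphD -!mul_mpolyC !rmorphM /= !rhoC !rhod !mxE.
  by rewrite -!/(x _) -!/(m _ _); ring.
have linE k : ((linear_form M (inord k)).@[base_point v 0])%:MP ^+ 2 = mu%:MP * x k.
  rewrite -rmorphXn /= -frobmul_linear_form eigen mxE mpolyCM mxE //.
(* [Q] does not involve [z], so its square is a constant plus multiples of [X0 ^+ 2] and
   [X1 ^+ 2]. *)
have [q0 [A1 [A2 qE]]] : exists q0 A1 A2, rho (mwiden Q) = q0%:MP + X0 * A1 + X1 * A2.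
  elim/mpoly_ring_ind: Q {F Fv} => [a|j|p q [a [A1 [A2 pE]]] [b [B1 [B2 qE]]]|
      p q [a [A1 [A2 pE]]] [b [B1 [B2 qE]]]].
  - by exists a, 0, 0; rewrite mwidenC rhoC !mulr0 !addr0.
  - rewrite mwidenX mnmwiden1; move: j; apply: forall_ord3;
      rewrite rhod; case: dE => [][d0 x0 d1 d2]; rewrite ?d0 ?d1 ?d2;
      [> exists (v 0 (widen (inord 0))), 0, 0 | exists (v 0 (widen (inord 0))), 1, 0
       | exists (v 0 (widen (inord 0))), 1, 0 | exists (v 0 (widen (inord 1))), 1, 0
       | exists (v 0 (widen (inord 1))), 0, 0 | exists (v 0 (widen (inord 1))), 0, 1
       | exists (v 0 (widen (inord 2))), 0, 1 | exists (v 0 (widen (inord 2))), 0, 1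
       | exists (v 0 (widen (inord 2))), 0, 0 ]; rewrite /x; ring.
  - by exists (a + b), (A1 + B1), (A2 + B2); rewrite mwidenD rmorphD pE qE mpolyCD; ring.
  exists (a * b), (a%:MP * B1 + b%:MP * A1 + A1 * (X0 * B1 + X1 * B2)),
    (a%:MP * B2 + b%:MP * A2 + A2 * (X0 * B1 + X1 * B2)).
  by rewrite mwidenM rmorphM pE qE mpolyCM; ring.
have four (p q : {mpoly K[3]}) : (p + q) ^+ 4 = p ^+ 4 + q ^+ 4.
  by rewrite -[4%N]/(2 * 2)%N !exprM !(mpoly_sqrrD charK).
(* The coefficient of [d j ^+ 2] coming from the squared linear forms. *)
pose N j := m 0%N j ^+ 2 * (x 1%N + d 1%N) * (x 2 + d 2)
  + m 1%N j ^+ 2 * (x 0%N + d 0%N) * (x 2 + d 2)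
  + m 2 j ^+ 2 * (x 0%N + d 0%N) * (x 1%N + d 1%N).
have key : rho F = X2 ^+ 4 + (A1 ^+ 2 * X0 ^+ 2 + A2 ^+ 2 * X1 ^+ 2
    + (N 0%N * d 0%N ^+ 2 + N 1%N * d 1%N ^+ 2 + N 2 * d 2 ^+ 2)
    + mu%:MP * (x 0%N * d 1%N * d 2 + x 1%N * d 0%N * d 2 + x 2 * d 0%N * d 1%N))
    + (c ^+ 4 + q0%:MP ^+ 2 + mu%:MP * x 0%N * x 1%N * x 2).
  rewrite /F quartic_formE rmorph_sum_squares rhoZ qE !rho_lin !rhod.
  rewrite -exprM four !(mpoly_sqrrD charK) !linE !exprMn.
  set L := LHS. set R := RHS.
  have -> : L = R + 2%:R * (mu%:MP * (x 0%N * x 1%N * x 2 + x 0%N * x 1%N * d 2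
    + x 0%N * x 2 * d 1%N + x 1%N * x 2 * d 0%N)) by rewrite /L /R /N; ring.
  by rewrite (mpoly2_eq0 charK) mul0r addr0.
(* The constant term, which is the value of the equation at the point and so vanishes. *)
pose kap := v 0 ord_max ^+ 4 + q0 ^+ 2 + mu * v 0 (widen (inord 0))
  * v 0 (widen (inord 1)) * v 0 (widen (inord 2)).
have kapE : c ^+ 4 + q0%:MP ^+ 2 + mu%:MP * x 0%N * x 1%N * x 2 = kap%:MP.
  by rewrite /x /c -!rmorphXn /= -!mpolyCM -!mpolyCD.
have [A [D]] : exists A D, rho F =
    X2 ^+ 4 + (A * X0 ^+ 2 + mu%:MP * X0 * X1 + D * X1 ^+ 2) + kap%:MP.
  case: dE => [][d0 x0 d1 d2]; rewrite key kapE d0 d1 d2 ?x0.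
  - by exists (A1 ^+ 2 + N 1%N), (A2 ^+ 2 + N 2); ring.
  - by exists (A1 ^+ 2 + N 0%N), (A2 ^+ 2 + N 2); ring.
  - by exists (A1 ^+ 2 + N 0%N), (A2 ^+ 2 + N 1%N); ring.
move=> rhoFE; have kap0 : kap = 0.
  have := rho0 F; rewrite Fv rhoFE !(mevalD, mevalM, mevalXU, mevalC) => E.
  by rewrite -[RHS]E; ring.
by rewrite rhoFE kap0 mpolyC0 addr0; apply: A3_normal_form.
Qed.

End A3Points.

(** * Singular points of the quartic surface *)

Section Lines.
Context (n : nat) (K : fieldType).
Implicit Types (P : proj_space n K) (v : 'rV[K]_n.+1).

Lemma proj_spaceP P : exists2 v, v != 0 & val P = <[v]>%VS.
Proof.
have dimP : \dim (val P) = 1%N by apply/eqP/(valP P).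
exists (vpick (val P)); first by rewrite vpick0 -dimv_eq0 dimP.
apply/esym/eqP; rewrite eqEdim -memvE memv_pick dimP dim_vline.
by rewrite vpick0 -dimv_eq0 dimP.
Qed.

Lemma proj_space_vline P v : v != 0 -> v \in val P -> val P = <[v]>%VS.
Proof.
move=> nzv vP; apply/esym/eqP; rewrite eqEdim -memvE vP dim_vline nzv.
by rewrite (eqP (valP P)).
Qed.

Lemma proj_space_eq P P' v : v != 0 -> v \in val P -> v \in val P' -> P = P'.
Proof.
by move=> nzv vP vP'; apply: val_inj; rewrite (proj_space_vline nzv vP) (proj_space_vline nzv vP').
Qed.

Lemma proj_space_exists v : v != 0 -> exists P, v \in val P.
Proof.
move=> nzv; have dimv : \dim <[v]> == 1%N by rewrite dim_vline nzv.
by exists (exist _ <[v]>%VS dimv); apply: memv_line.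
Qed.

End Lines.

(** * Singular points as fixed or kernel directions of the semilinear map *)

Section QuarticPoints.
Context (K : closedFieldType) (charK : 2%N \in [pchar K]).
Local Notation frob := (pFrobenius_aut charK).
Local Notation widen i := (widen_ord (leqnSn 3) i).
Context (B : dhomog 3 K 4) (Q : {mpoly K[3]}) (M : 'M[K]_3).
Context (BE : val B = quartic_form Q M).
Local Notation F := (quartic B).
Local Notation phi := (frobmul charK (map_mx frob M^T)).
Implicit Types (P : proj_space 3 K) (v : 'rV[K]_4) (x : 'rV[K]_3).

Lemma quarticE : F = quartic (quartic_form Q M).
Proof. by rewrite -BE. Qed.

Definition cone_point x z : 'rV[K]_4 :=
  \row_j if unlift ord_max j is Some i then x 0 i else z.

Lemma cone_point_max x z : cone_point x z 0 ord_max = z.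
Proof. by rewrite mxE unlift_none. Qed.

Lemma cone_pointK x z : base_point (cone_point x z) = x.
Proof.
apply/rowP => i; rewrite !mxE.
have -> : widen i = lift ord_max i by apply/val_inj/esym/lift_max.
by rewrite liftK.
Qed.

Lemma cone_pointE v : v = cone_point (base_point v) (v 0 ord_max).
Proof.
apply/rowP => j; rewrite !mxE; case: unliftP => [i ->|-> //].
by rewrite mxE; congr (v _ _); apply/val_inj/lift_max.
Qed.

Lemma base_pointZ c v : base_point (c *: v) = c *: base_point v.
Proof. by apply/rowP => i; rewrite !mxE. Qed.

Lemma quarticZ c v : F.@[(c *: v) 0] = c ^+ 4 * F.@[v 0].
Proof.
rewrite !meval_quartic mxE exprMn mulrDr; congr (_ + _).
rewrite -(meval_dhomog _ _ (dhomog_is_dhomog B)); apply: meval_eq => i.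
by rewrite !mxE.
Qed.

Lemma frob4_inj (a b : K) : a ^+ 4 = b ^+ 4 -> a = b.
Proof.
rewrite -[4%N]/(2 * 2)%N !exprM -!(pFrobenius_autE charK).
by do 2!move/(fmorph_inj frob).
Qed.

(** Fourth powers determine [z] in characteristic 2, so the projection to the plane is injective on
    the surface. *)
Lemma quartic_point_prop v v' c : F.@[v 0] = 0 -> F.@[v' 0] = 0 ->
  base_point v' = c *: base_point v -> v' = c *: v.
Proof.
move=> Fv Fv' E; have Fcv : F.@[(c *: v) 0] = 0 by rewrite quarticZ Fv mulr0.
rewrite [LHS]cone_pointE [RHS]cone_pointE base_pointZ E; congr cone_point.
apply: frob4_inj; move: Fv' Fcv; rewrite !meval_quartic E base_pointZ => <-.
by move/esym/addIr.
Qed.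

Lemma base_point_neq0 v : v != 0 -> F.@[v 0] = 0 -> base_point v != 0.
Proof.
move=> nzv Fv; apply: contra nzv => /eqP x0.
have F0 : F.@[(0 : 'rV[K]_4) 0] = 0.
  by have := quarticZ 0 0; rewrite scale0r expr0n mul0r.
by rewrite (quartic_point_prop (c := 0) F0 Fv) ?scaler0 // x0 scale0r.
Qed.

(** If [phi x = c x] with [c != 0], then [c^-1 x] is fixed, since [phi] squares scalars. *)
Lemma singular_quartic_vec P : singular_point F P -> exists v,
  [/\ v \in val P, base_point v != 0, F.@[v 0] = 0 &
      phi (base_point v) = base_point v \/ phi (base_point v) = 0].
Proof.
move=> sP; have [v nzv PE] := proj_spaceP P.
have vP : v \in val P by rewrite PE memv_line.
have [Fv dFv] := sP v vP; have nzx := base_point_neq0 nzv Fv.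
rewrite quarticE in dFv; move/(mderiv_quartic_formP charK): dFv.
move/(cross_zeroP charK _ nzx) => [c xE].
have [c0|nzc] := eqVneq c 0.
  by exists v; split=> //; right; rewrite xE c0 scale0r.
exists (c^-1 *: v); split.
- by rewrite memvZ.
- by rewrite base_pointZ scaler_eq0 invr_eq0 (negbTE nzc).
- by rewrite quarticZ Fv mulr0.
left; rewrite base_pointZ frobmulZ xE scalerA; congr (_ *: _); by field.
Qed.

Lemma singular_quarticI P v c : v \in val P -> v != 0 -> F.@[v 0] = 0 ->
  phi (base_point v) = c *: base_point v -> singular_point F P.
Proof.
move=> vP nzv Fv xE w; rewrite (proj_space_vline nzv vP) => /vlineP[a ->].
rewrite quarticZ Fv mulr0; split=> //.
rewrite quarticE; apply/(mderiv_quartic_formP charK).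
rewrite base_pointZ frobmulZ xE; set x := base_point v.
have two0 : 2%:R = 0 :> K by apply: pcharf0.
have sw (s t : K) : a * s * (a ^+ 2 * (c * t)) + a * t * (a ^+ 2 * (c * s)) = 0.
  transitivity (2%:R * (a ^+ 3 * c * s * t)); first by ring.
  by rewrite two0 mul0r.
by split; rewrite !mxE; apply: sw.
Qed.

Lemma singular_quartic_A3 P : map_mx frob M^T \in unitmx -> singular_point F P ->
  A_singularity 3 F P.
Proof.
move=> unitA sP; have [v [vP nzx Fv _]] := singular_quartic_vec sP.
have [i nzi] := rV0Pn _ nzx; rewrite mxE in nzi.
pose w := (v 0 (widen i))^-1 *: v.
have wP : w \in val P by rewrite memvZ.
have w1 : w 0 (widen i) = 1 by rewrite mxE mulVf.
have [Fw dFw] := sP w wP.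
have nzw : base_point w != 0.
  by apply/rV0Pn; exists i; rewrite mxE w1 oner_eq0.
rewrite quarticE in dFw; move/(mderiv_quartic_formP charK): dFw.
move/(cross_zeroP charK _ nzw) => [c xE].
exists (widen i), w; split=> //.
rewrite quarticE in Fw *.
apply: (quartic_chart_A3 (charK := charK) (mu := c)) => //.
apply: contra nzw => /eqP c0; move: xE; rewrite c0 scale0r.
move/(congr1 (mulmx^~ (invmx (map_mx frob M^T)))); rewrite mulmxK // mul0mx => /eqP.
by rewrite map_mx_eq0.
Qed.

(** In rank at most 1, writing [M = c l] makes every [L_i] a multiple of one linear form [L]; then
    [B = Q^2 + L^2 T], which [not_normal] excludes. *)
Lemma normal_rank : normal_hypersurface F -> (1 < \rank (map_mx frob M^T))%N.
Proof.
move=> normF; rewrite ltnNge; apply/negP; rewrite mxrank_map mxrank_tr => rkM.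
have [c [l ME]] : exists (c : 'cV[K]_3) (l : 'rV[K]_3), M = c *m l.
  move: (mulmx_base M) rkM; move: (col_base M) (row_base M).
  case: (\rank M) => [|[|k]] C R CRM rk; rewrite -CRM //; last by exists C, R.
  by exists 0, 0; rewrite [C]thinmx0 !mul0mx.
pose L : {mpoly K[3]} := \sum_j l 0 j *: 'X_j.
have LE (x : 'rV[K]_3) : L.@[x 0] = \sum_j l 0 j * x 0 j.
  by rewrite raddf_sum; apply: eq_bigr => j _; rewrite /= mevalZ mevalXU.
have linE i : linear_form M i = (c i 0)%:MP * L.
  rewrite mul_mpolyC scaler_sumr; apply: eq_bigr => j _.
  by rewrite ME !mxE big_ord1 scalerA.
(* A projective zero of [L]: a unit vector if the first coefficient vanishes, otherwise
   [(l_1, -l_0, 0)]. *)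
have [a nza la] : exists2 a : 'rV[K]_3, a != 0 & \sum_j l 0 j * a 0 j = 0.
  have [l0|nzl] := eqVneq (l 0 (inord 0)) 0.
    exists (delta_mx 0 (inord 0)).
      by apply/rV0Pn; exists (inord 0); rewrite mxE !eqxx oner_eq0.
    rewrite (bigD1 (inord 0)) //= l0 mul0r add0r big1 // => j nej.
    by rewrite mxE (negbTE nej) andbF mulr0.
  exists (\row_j [:: l 0 (inord 1); - l 0 (inord 0); 0]`_j).
    by apply/rV0Pn; exists (inord 1); rewrite mxE inordK //= oppr_eq0.
  by rewrite sum_ord3 !mxE !inordK //=; ring.
have [i nzi] := rV0Pn _ nza.
apply: (@not_normal K charK (val B) Q L ('X_(inord 1) * 'X_(inord 2) * (c (inord 0) 0)%:MP ^+ 2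
  + 'X_(inord 0) * 'X_(inord 2) * (c (inord 1) 0)%:MP ^+ 2
  + 'X_(inord 0) * 'X_(inord 1) * (c (inord 2) 0)%:MP ^+ 2) ((a 0 i)^-1 *: a) i) => //.
- by rewrite BE /quartic_form !linE; ring.
- rewrite LE; under eq_bigr do rewrite mxE mulrCA.
  by rewrite -mulr_sumr la mulr0.
by rewrite mxE mulVf.
Qed.

Lemma normal_singular_le7 (s : seq (proj_space 3 K)) : normal_hypersurface F ->
  uniq s -> (forall P, P \in s -> singular_point F P) -> (size s <= 7)%N.
Proof.
move=> /normal_rank rkA uniq_s sing_s.
have /boolp.choice[f fP] : forall P, exists v, P \in s ->
  [/\ v \in val P, base_point v != 0, F.@[v 0] = 0 &
      phi (base_point v) = base_point v \/ phi (base_point v) = 0].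
  move=> P; have [/sing_s/singular_quartic_vec[v vP]|_] := boolP (P \in s).
    by exists v.
  by exists 0.
have f_prop P P' c : P \in s -> P' \in s ->
    base_point (f P') = c *: base_point (f P) -> P = P'.
  move=> /fP[vP nzx Fv _] /fP[vP' nzx' Fv' _] /(quartic_point_prop Fv Fv') E.
  apply: (@proj_space_eq _ _ _ _ (f P')) => //; last by rewrite E memvZ.
  by apply: contraNneq nzx' => ->; apply/eqP/rowP => i; rewrite !mxE.
rewrite -(size_map (fun P => base_point (f P))).
apply: (frobmul_directions_le7 rkA).
- rewrite map_inj_in_uniq // => P P' Ps Ps' E.
  by apply: (f_prop P P' 1) => //; rewrite scale1r.
- by apply/mapP => -[P /fP[_ nzx _ _] x0]; rewrite -x0 eqxx in nzx.
- by move=> _ /mapP[P /fP[_ _ _ H] ->].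
move=> _ _ /mapP[P Ps ->] /mapP[P' Ps' ->] c /(f_prop _ _ _ Ps Ps') -> //.
Qed.

(** In the fixed basis formed by the rows of [g], the fixed vectors of [phi] are those with
    coordinates in [F_2], and invertibility excludes a kernel. The singular points thus correspond
    to the [2^3 - 1] nonzero vectors of [F_2^3], each lifted to the surface by a fourth root. *)
Lemma nondegenerate_singular : map_mx frob M^T \in unitmx ->
  exists s : seq (proj_space 3 K),
       [/\ uniq s, size s = 7%N,
           forall P, singular_point F P <-> P \in s &
           forall P, P \in s -> A_singularity 3 F P].
Proof.
move=> unitA; have [g unitg gfix] := frobmul_fixed_basis charK unitA.
pose r (c : {ffun 'I_3 -> bool}) : 'rV[K]_3 := \row_i (c i)%:R.
(* A scalar carrying one vector of zeros and ones to a nonzero one must be 1, so distinct nonzero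
   vectors span distinct lines. *)
have r_inj c c' k : c' != [ffun=> false] -> r c' = k *: r c -> c = c'.
  move=> nzc' E; have Ei i : (c' i)%:R = k * (c i)%:R :> K.
    by move/rowP/(_ i): E; rewrite !mxE.
  have [i ci] : exists i, c' i.
    apply/existsP; apply: contraR nzc'; rewrite negb_exists => /forallP H.
    by apply/eqP/ffunP => i; rewrite ffunE; apply/negbTE.
  have k1 : k = 1.
    have := Ei i; rewrite ci; case: (c i); rewrite ?mulr1 ?mulr0 // => /eqP.
    by rewrite oner_eq0.
  apply/ffunP => j; have := Ei j; rewrite k1 mul1r.
  by case: (c j); case: (c' j) => // /eqP; rewrite ?oner_eq0 // eq_sym oner_eq0.
have r_fix c : phi (r c *m g) = r c *m g.
  rewrite /frobmul map_mxM -mulmxA gfix; congr (_ *m _); apply/rowP => i.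
  by rewrite !mxE rmorph_nat.
have r_neq0 c : c != [ffun=> false] -> r c *m g != 0.
  move=> nzc; apply: contra nzc => /eqP /(congr1 (mulmx^~ (invmx g))).
  rewrite mulmxK // mul0mx => /rowP r0; apply/eqP/ffunP => i; rewrite ffunE.
  have /eqP := r0 i; rewrite !mxE; case: (c i) => //; by rewrite oner_eq0.
have /boolp.choice[f fP] : forall c, exists P, c != [ffun=> false] -> exists v,
    [/\ v \in val P, v != 0, F.@[v 0] = 0 & base_point v = r c *m g].
  move=> c; have [z zE] := nth_root_exists (- (val B).@[(r c *m g) 0]) (isT : 0 < 4)%N.
  have [c0|nzc] := eqVneq c [ffun=> false].
    have nz1 : const_mx 1 != 0 :> 'rV[K]_4.
      by apply/rV0Pn; exists 0; rewrite mxE oner_eq0.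
    by have [P _] := proj_space_exists nz1; exists P.
  have nzv : cone_point (r c *m g) z != 0.
    apply: contraNneq (r_neq0 c nzc) => v0; rewrite -(cone_pointK (r c *m g) z) v0.
    by apply/eqP/rowP => i; rewrite !mxE.
  have [P vP] := proj_space_exists nzv; exists P => _; exists (cone_point (r c *m g) z).
  split=> //; last exact: cone_pointK.
  by rewrite meval_quartic cone_point_max cone_pointK zE addNr.
pose cs := enum (predC1 ([ffun=> false] : {ffun 'I_3 -> bool})).
have csP c : (c \in cs) = (c != [ffun=> false]) by rewrite mem_enum inE.
have memP P : singular_point F P <-> P \in map f cs.
  split=> [sP|/mapP[c]]; last first.
    rewrite csP => /fP[v [vP nzv Fv xE]] ->.
    by apply: (singular_quarticI vP nzv Fv (c := 1)); rewrite scale1r xE r_fix.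
  have [v [vP nzx Fv phix]] := singular_quartic_vec sP.
  pose t := base_point v *m invmx g.
  have tE : base_point v = t *m g by rewrite mulmxKV.
  clearbody t.
  have {}phix : phi (base_point v) = base_point v.
    case: phix => // x0; case/eqP: nzx.
    move/(congr1 (mulmx^~ (invmx (map_mx frob M^T)))): x0; rewrite mulmxK // mul0mx => /eqP.
    by rewrite map_mx_eq0 => /eqP.
  have t_fix : map_mx frob t = t.
    move: phix; rewrite tE /frobmul map_mxM -mulmxA gfix => /(congr1 (mulmx^~ (invmx g))).
    by rewrite !mulmxK.
  pose c := [ffun i => t 0 i == 1].
  have tc : t = r c.
    apply/rowP => i; rewrite mxE ffunE; move/rowP/(_ i): t_fix; rewrite mxE /= pFrobenius_autE.
    move/eqP; rewrite -subr_eq0 expr2 -{3}[t 0 i]mulr1 -mulrBr mulf_eq0 subr_eq0.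
    by case/orP => /eqP => ->; rewrite ?eqxx // eq_sym oner_eq0.
  have nzc : c != [ffun=> false].
    apply: contraNneq nzx => c0; rewrite tE tc c0.
    by apply/eqP; rewrite (_ : r _ = 0) ?mul0mx //; apply/rowP => i; rewrite !mxE ffunE.
  apply/mapP; exists c; first by rewrite csP.
  have [w [wP nzw Fw wE]] := fP c nzc.
  have wv : w = v.
    by rewrite -[RHS]scale1r; apply: quartic_point_prop => //; rewrite wE tE tc scale1r.
  by apply: (proj_space_eq nzw) => //; rewrite wv.
exists (map f cs); split=> //.
- rewrite map_inj_in_uniq ?enum_uniq // => c c'; rewrite !csP => nzc nzc' E.
  have [v [vP nzv Fv xE]] := fP c nzc; have [v' [vP' nzv' Fv' xE']] := fP c' nzc'.
  move: vP'; rewrite -E (proj_space_vline nzv vP) => /vlineP[k v'E].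
  apply: (r_inj c c' k) => //; apply: (can_inj (mulmxK unitg)).
  by rewrite -xE' v'E base_pointZ xE scalemxAl.
- by rewrite size_map -cardE cardC1 card_ffun card_bool card_ord.
by move=> P /memP; apply: singular_quartic_A3.
Qed.

End QuarticPoints.

(** * Openness of the non-degeneracy condition, and conclusion *)

Lemma hessian_mx_sum (K : closedFieldType) I r (c : I -> K) (p : I -> {mpoly K[3]}) :
  hessian_mx (\sum_(i <- r) c i *: p i) = \sum_(i <- r) c i *: hessian_mx (p i).
Proof.
apply/matrixP => j i; rewrite mxE (raddf_sum (mderiv (inord ((i + 1) %% 3)))).
rewrite (raddf_sum (mderiv (inord ((i + 2) %% 3)))) (raddf_sum (meval _)) summxE.
by apply: eq_bigr => k _; rewrite /= !mderivZ mevalZ !mxE.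
Qed.

(** The Hessian matrix is linear in [B], so its determinant is one polynomial in the coordinates of
    [B]. *)
Lemma hessian_open (K : closedFieldType) :
  zariski_open (fun B : dhomog 3 K 4 => \det (hessian_mx B) != 0).
Proof.
set V := dhomog 3 K 4; pose b := vbasis {:V}.
pose H : 'M[{mpoly K[\dim {:V}]}]_3 :=
  \matrix_(j, i) \sum_k (hessian_mx (tnth b k) j i)%:MP * 'X_k.
have HE (B : V) : (\det H).@[fun j => coord b j B] = \det (hessian_mx B).
  rewrite -det_map_mx; congr (\det _); apply/matrixP => j i.
  have BE : mpoly_of_dhomog B = \sum_k coord b k B *: mpoly_of_dhomog b`_k.
    by rewrite {1}(coord_vbasis (memvf B)) raddf_sum.
  rewrite BE hessian_mx_sum summxE !mxE raddf_sum; apply: eq_bigr => k _ /=.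
  by rewrite mevalM mevalC mevalXU mulrC [in RHS]mxE (tnth_nth 0).
exists (eq (\det H)) => B; split=> [nz|[_ [<-]]]; last by rewrite HE.
by exists (\det H); rewrite HE.
Qed.

Theorem corollary8 (K : closedFieldType) (charK : 2%N \in [pchar K]) :
  (forall B : dhomog 3 K 4,
     normal_hypersurface (quartic B) ->
     forall s : seq (proj_space 3 K),
       uniq s -> (forall P, P \in s -> singular_point (quartic B) P) ->
       (size s <= 7)%N)
  /\
  holds_generally (fun B : dhomog 3 K 4 =>
     exists s : seq (proj_space 3 K),
       [/\ uniq s, size s = 7%N,
           forall P, singular_point (quartic B) P <-> P \in s &
           forall P, P \in s -> A_singularity 3 (quartic B) P]).
Proof.
split=> [B normB s uniq_s sing_s|].
  have [Q [M BE]] := quartic_formP charK B.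
  exact: (normal_singular_le7 charK BE normB uniq_s sing_s).
exists (fun B : dhomog 3 K 4 => \det (hessian_mx B) != 0); split.
- exact: hessian_open.
(* Non-emptiness: [Q = 0] and [M = 1] give the quartic [x_1 x_2 x_3 (x_1 + x_2 + x_3)], whose
   Hessian matrix is the identity. *)
- have homB : quartic_form 0 (1%:M : 'M[K]_3) \is 4.-homog.
    have homX i : ('X_i : {mpoly K[3]}) \is 1.-homog by rewrite dhomogX /= mdeg1.
    have homL i : linear_form (1%:M : 'M[K]_3) i \is 1.-homog.
      by apply: rpred_sum => j _; apply: rpredZ.
    have homT i j k : 'X_i * 'X_j * linear_form (1%:M : 'M[K]_3) k ^+ 2 \is 4.-homog.
      exact: (dhomogM (dhomogM (homX i) (homX j)) (dhomogMn 2 (homL k))).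
    by rewrite /quartic_form expr0n add0r !rpredD.
  exists (DHomog homB); rewrite [mpoly_of_dhomog _]/= (hessian_form charK).
  by rewrite trmx1 map_mx1 det1 oner_eq0.
move=> B nzdet; have [Q [M BE]] := quartic_formP charK B.
apply: (nondegenerate_singular (charK := charK) BE); rewrite unitmxE unitfE.
by rewrite -(hessian_form charK Q) -BE.
Qed.
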